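(* Let $\mathcal{X}$ and $\mathcal{Y}$ be complex Banach spaces, and let $A\in L(\mathcal{X})$ and $B\in L(\mathcal{Y})$ be such that $0\notin\operatorname{acc}\sigma_d(A)$ or $0\notin\operatorname{acc}\sigma_p(B)$. For $C\in L(\mathcal{Y},\mathcal{X})$ write $M_C=\begin{pmatrix} A & C\\ 0 & B\end{pmatrix}\in L(\mathcal{X}\oplus\mathcal{Y})$. (i) If there exists some $C\in L(\mathcal{Y},\mathcal{X})$ such that $M_C$ is generalized Drazin invertible, then $A$ and $B$ are both generalized Drazin invertible. (ii) If there exists some $C\in L(\mathcal{Y},\mathcal{X})$ such that $M_C$ is Drazin invertible, then $A$ and $B$ are both Drazin invertible. (iii) If there exists some $C\in L(\mathcal{Y},\mathcal{X})$ such that $M_C$ is invertible, then $A$ and $B$ are both invertible.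
   Context: $L(\mathcal{X},\mathcal{Y})$ is the set of bounded linear operators from $\mathcal{X}$ to $\mathcal{Y}$, and $L(\mathcal{X})=L(\mathcal{X},\mathcal{X})$. $T-\lambda$ means $T-\lambda I$. The space $\mathcal{X}\oplus\mathcal{Y}$ of pairs carries the norm $\|(x,y)\|=(\|x\|^2+\|y\|^2)^{1/2}$, and $M_C(x,y)=(Ax+Cy,By)$. For $T\in L(\mathcal{X})$ with range $R(\cdot)$: the point spectrum is $\sigma_p(T)=\{\lambda\in\mathbb{C}: T-\lambda \text{ is not injective}\}$ and the defect spectrum is $\sigma_d(T)=\{\lambda\in\mathbb{C}:\overline{R(T-\lambda)}\neq\mathcal{X}\}$. For $K\subset\mathbb{C}$, $\operatorname{acc}K$ is the set of accumulation points of $K$. $T$ is quasinilpotent if $T-\lambda$ is invertible for all complex $\lambda\neq0$. $T$ is Drazin invertible if there exist $S\in L(\mathcal{X})$ and $k\in\mathbb{N}$ with $TS=ST$, $STS=S$, $T^kST=T^k$. $T$ is generalized Drazin invertible if there exists $S\in L(\mathcal{X})$ with $TS=ST$, $STS=S$ and $TST-T$ quasinilpotent. *)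

(* Defs.v *)
From Stdlib Require Import Reals.
From Coquelicot Require Import Coquelicot.

Open Scope R_scope.

(* L(X, Y) is Coquelicot's [is_linear] (additive, homogeneous and bounded), a
   predicate on functions; equality of operators is pointwise.  On pairs,
   Coquelicot's canonical norm is sqrt (norm x ^ 2 + norm y ^ 2). *)

Section Operators.

Context {X : NormedModule C_AbsRing}.

Definition shift (T : X -> X) (lambda : C) : X -> X :=
  fun x => minus (T x) (scal (lambda : C_AbsRing) x).

Definition injective (T : X -> X) : Prop :=
  forall x y : X, T x = T y -> x = y.

Definition range (T : X -> X) : X -> Prop :=
  fun y => exists x : X, T x = y.

Definition closure (D : X -> Prop) : X -> Prop :=
  fun y => forall eps : R, 0 < eps -> exists z : X, D z /\ norm (minus z y) < eps.

Definition sigma_p (T : X -> X) : C -> Prop :=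
  fun lambda => ~ injective (shift T lambda).

Definition sigma_d (T : X -> X) : C -> Prop :=
  fun lambda => ~ (forall y : X, closure (range (shift T lambda)) y).

Definition invertible (T : X -> X) : Prop :=
  exists S : X -> X,
    is_linear S /\ (forall x, S (T x) = x) /\ (forall x, T (S x) = x).

Definition quasinilpotent (T : X -> X) : Prop :=
  forall lambda : C, lambda <> RtoC 0 -> invertible (shift T lambda).

Definition drazin_invertible (T : X -> X) : Prop :=
  exists (S : X -> X) (k : nat),
    is_linear S /\
    (forall x, T (S x) = S (T x)) /\
    (forall x, S (T (S x)) = S x) /\
    (forall x, Nat.iter k T (S (T x)) = Nat.iter k T x).

Definition generalized_drazin_invertible (T : X -> X) : Prop :=
  exists S : X -> X,
    is_linear S /\
    (forall x, T (S x) = S (T x)) /\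
    (forall x, S (T (S x)) = S x) /\
    quasinilpotent (fun x => minus (T (S (T x))) (T x)).

End Operators.

Definition acc (K : C -> Prop) : C -> Prop :=
  fun z => forall eps : R, 0 < eps ->
    exists w : C, K w /\ w <> z /\ Cmod (Cminus w z) < eps.

Definition upper_triangular {X Y : NormedModule C_AbsRing}
    (A : X -> X) (B : Y -> Y) (C : Y -> X) : X * Y -> X * Y :=
  fun p => (plus (A (fst p)) (C (snd p)), B (snd p)).

(* Main.v *)
Require Import Defs.
From Stdlib Require Import Reals Lra Lia List Classical IndefiniteDescription.
From Coquelicot Require Import Coquelicot.

(** Let [S] be the given inverse of [M = M_C] (ordinary, Drazin or generalized Drazin).
    In all three cases [S] is a bounded operator with [M S = S M] and [S M S = S], and the
    defect [Q = M S M - M] is topologically nilpotent: [r ^ n |Q ^ n| -> 0] along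
    [n = 2 ^ m], for every [r].  The heart of the matter is that [S] maps the first summand [X] into itself, i.e.
    that [S] is upper triangular ([outer_inverse_upper_triangular]).  All the algebraic
    relations between [M] and [S], as well as the topological nilpotence of the defect,
    then pass to the diagonal entries of [S], which are therefore inverses of the required
    kind of [A] and [B].

    The spectral hypothesis is used to show that, for small [l <> 0], an element which
    [M - l] maps into [X] lies in [X] ([upper_triangular_preimage]).  Since [M ^ n - r ^ n]
    is for [n = 2 ^ m] a product of factors [M - l] with [|l| = r], the same holds for
    [M ^ n - r ^ n].  Put [P = I - S M].  On the range of [P] the powers of [M] are, up to
    sign, those of [Q], and on the range of [S M] the operator [S] inverts [M]; hence
    [(M ^ n - r ^ n) ^ -1 M ^ n] exists and tends, as [n] grows, to [S M] when [r] is
    small.  As [X] is closed, it is invariant under [S M] ([idempotent_invariant]), and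
    from this under [S] ([outer_inverse_invariant]).  The limit replaces the contour
    integral that defines the spectral idempotent.

    In the generalized Drazin case the topological nilpotence of the quasinilpotent
    operator [Q] is the spectral radius formula.  It is obtained without complex
    integration ([quasinilpotent_top_nilpotent]) from the identity
    [(I - d ^ 2 Q ^ 2) ^ -1 = ((I - d Q) ^ -1 + (I + d Q) ^ -1) / 2]: along repeated
    squarings, the inverses of [I - s ^ n u Q ^ n] ([|u| = 1]) inherit the modulus of
    continuity in [s] of the inverses of [I - s u Q].  The converse, that topologically
    nilpotent operators are quasinilpotent, follows from the Neumann series. *)

(** * Normalisation of linear combinations *)

(** Formal linear combinations with complex coefficients of atoms given by their
    position in a list. *)
Inductive lexp : Type :=
| LZero : lexp
| LAtom : nat -> lexp
| LPlus : lexp -> lexp -> lexp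
| LMinus : lexp -> lexp -> lexp
| LOpp : lexp -> lexp
| LScal : C -> lexp -> lexp.

Fixpoint leval {V : NormedModule C_AbsRing} (env : list V) (e : lexp) : V :=
  match e with
  | LZero => zero
  | LAtom n => nth n env zero
  | LPlus a b => plus (leval env a) (leval env b)
  | LMinus a b => minus (leval env a) (leval env b)
  | LOpp a => opp (leval env a)
  | LScal c a => scal (c : C_AbsRing) (leval env a)
  end.

(** Coefficient of the [k]-th atom. *)
Fixpoint lcoef (e : lexp) (k : nat) : C :=
  match e with
  | LZero => RtoC 0
  | LAtom n => if Nat.eqb n k then RtoC 1 else RtoC 0
  | LPlus a b => Cplus (lcoef a k) (lcoef b k)
  | LMinus a b => Cminus (lcoef a k) (lcoef b k)
  | LOpp a => Copp (lcoef a k)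
  | LScal c a => Cmult c (lcoef a k)
  end.

(** The combination of the atoms with coefficients [f 0, f 1, ...]. *)
Fixpoint lcomb {V : NormedModule C_AbsRing} (env : list V) (f : nat -> C) : V :=
  match env with
  | nil => zero
  | v :: t => plus (scal (f O : C_AbsRing) v) (lcomb t (fun k => f (S k)))
  end.

Lemma lcomb_ext {V : NormedModule C_AbsRing} (env : list V) :
  forall f g, (forall k, f k = g k) -> lcomb env f = lcomb env g.
Proof.
  induction env as [|v t IH]; intros f g H; simpl; [reflexivity|].
  rewrite H, (IH _ (fun k => g (S k))); auto.
Qed.

Lemma scal_C0 {V : NormedModule C_AbsRing} (v : V) :
  scal (RtoC 0 : C_AbsRing) v = (zero : V).
Proof. exact (scal_zero_l (K := C_AbsRing) v). Qed.

Lemma scal_C1 {V : NormedModule C_AbsRing} (v : V) :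
  scal (RtoC 1 : C_AbsRing) v = v.
Proof. exact (scal_one (K := C_AbsRing) v). Qed.

Lemma lcomb_zero {V : NormedModule C_AbsRing} (env : list V) :
  lcomb env (fun _ => RtoC 0) = zero.
Proof.
  induction env as [|v t IH]; simpl; [reflexivity|].
  now rewrite IH, scal_C0, plus_zero_l.
Qed.

Lemma plus_plus_swap {V : NormedModule C_AbsRing} (a b c d : V) :
  plus (plus a b) (plus c d) = plus (plus a c) (plus b d).
Proof.
  rewrite <- !plus_assoc. f_equal. rewrite !plus_assoc. f_equal. apply plus_comm.
Qed.

Lemma lcomb_plus {V : NormedModule C_AbsRing} (env : list V) :
  forall f g, lcomb env (fun k => Cplus (f k) (g k)) = plus (lcomb env f) (lcomb env g).
Proof.
  induction env as [|v t IH]; intros f g; simpl.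
  - now rewrite plus_zero_l.
  - rewrite IH. etransitivity; [|apply plus_plus_swap].
    f_equal. exact (scal_distr_r (K := C_AbsRing) (f O) (g O) v).
Qed.

Lemma lcomb_scal {V : NormedModule C_AbsRing} (env : list V) (c : C) :
  forall f, lcomb env (fun k => Cmult c (f k)) = scal (c : C_AbsRing) (lcomb env f).
Proof.
  induction env as [|v t IH]; intros f; simpl.
  - symmetry. exact (scal_zero_r (K := C_AbsRing) (V := V) c).
  - rewrite IH. etransitivity; [|symmetry; exact (scal_distr_l (K := C_AbsRing) c (scal (f O : C_AbsRing) v) _)].
    f_equal. symmetry. exact (scal_assoc (K := C_AbsRing) c (f O) v).
Qed.

Lemma lcomb_opp {V : NormedModule C_AbsRing} (env : list V) f :
  lcomb env (fun k => Copp (f k)) = opp (lcomb env f).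
Proof.
  rewrite (lcomb_ext _ _ (fun k => Cmult (Copp (RtoC 1)) (f k))).
  - rewrite lcomb_scal. exact (scal_opp_one (K := C_AbsRing) (V := V) _).
  - intros k. ring.
Qed.

Lemma lcomb_atom {V : NormedModule C_AbsRing} (env : list V) :
  forall n, lcomb env (lcoef (LAtom n)) = nth n env zero.
Proof.
  induction env as [|v t IH]; intros [|n]; simpl; try reflexivity.
  - rewrite scal_C1.
    change (plus v (lcomb t (fun _ => RtoC 0)) = v).
    now rewrite lcomb_zero, plus_zero_r.
  - rewrite scal_C0, plus_zero_l. apply (IH n).
Qed.

Lemma leval_lcomb {V : NormedModule C_AbsRing} (env : list V) (e : lexp) :
  leval env e = lcomb env (lcoef e).
Proof.
  induction e as [|n|a IHa b IHb|a IHa b IHb|a IHa|c a IHa]; cbn [leval].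
  - symmetry. apply lcomb_zero.
  - symmetry. apply lcomb_atom.
  - rewrite IHa, IHb. symmetry. apply lcomb_plus.
  - rewrite IHa, IHb. unfold minus. rewrite <- lcomb_opp. symmetry.
    apply (lcomb_plus env (lcoef a) (fun k => Copp (lcoef b k))).
  - rewrite IHa. symmetry. apply lcomb_opp.
  - rewrite IHa. symmetry. apply lcomb_scal.
Qed.

Lemma leval_eq {V : NormedModule C_AbsRing} (env : list V) (e1 e2 : lexp) :
  lcomb env (lcoef e1) = lcomb env (lcoef e2) -> leval env e1 = leval env e2.
Proof. now rewrite !leval_lcomb. Qed.

Ltac atom_index x env :=
  lazymatch env with
  | x :: _ => constr:(O)
  | _ :: ?t => let n := atom_index x t in constr:(S n)
  end.

Ltac add_atom x env :=
  match env with
  | _ => let n := atom_index x env in env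
  | _ => constr:(x :: env)
  end.

Ltac atoms e env :=
  lazymatch e with
  | zero => env
  | plus ?a ?b => let env := atoms a env in atoms b env
  | minus ?a ?b => let env := atoms a env in atoms b env
  | opp ?a => atoms a env
  | scal _ ?a => atoms a env
  | _ => add_atom e env
  end.

Ltac reify_vec e env :=
  lazymatch e with
  | zero => constr:(LZero)
  | plus ?a ?b => let a := reify_vec a env in let b := reify_vec b env in constr:(LPlus a b)
  | minus ?a ?b => let a := reify_vec a env in let b := reify_vec b env in constr:(LMinus a b)
  | opp ?a => let a := reify_vec a env in constr:(LOpp a)
  | scal ?c ?a => let a := reify_vec a env in constr:(LScal c a)
  | _ => let n := atom_index e env in constr:(LAtom n)
  end.

(** Reduces an equation between linear combinations of vectors to the equality of
    the complex coefficients of each atom. *)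
Ltac vec_with tac :=
  lazymatch goal with
  | |- @eq ?T ?a ?b =>
    let env := atoms a (@nil T) in
    let env := atoms b env in
    let ea := reify_vec a env in
    let eb := reify_vec b env in
    change (leval env ea = leval env eb);
    apply leval_eq; cbn [lcomb lcoef Nat.eqb];
    repeat (apply f_equal2; [apply f_equal2; [tac|reflexivity]|]); try reflexivity
  end.

Ltac vec := vec_with ltac:(lazymatch goal with |- ?x = ?y => change (@eq C x y) end; try ring).


(** * Bounded operators and their squarings *)

Lemma norm_scal_C {V : NormedModule C_AbsRing} (c : C) (x : V) :
  norm (scal (c : C_AbsRing) x) <= Cmod c * norm x.
Proof. exact (norm_scal (c : C_AbsRing) x). Qed.

Lemma norm_scal_C_eq {V : NormedModule C_AbsRing} (c : C) (x : V) :
  norm (scal (c : C_AbsRing) x) = Cmod c * norm x.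
Proof.
  destruct (Ceq_dec c (RtoC 0)) as [->|Hc].
  - rewrite scal_C0, Cmod_0. rewrite norm_zero. ring.
  - apply Rle_antisym; [apply norm_scal_C|].
    assert (Hx : x = scal (Cinv c : C_AbsRing) (scal (c : C_AbsRing) x)) by (vec; now field).
    assert (H := norm_scal_C (Cinv c) (scal (c : C_AbsRing) x)).
    rewrite <- Hx, Cmod_inv in H by assumption.
    assert (Hm : 0 < Cmod c) by now apply Cmod_gt_0.
    apply (Rmult_le_compat_l (Cmod c)) in H; [|lra].
    now rewrite <- Rmult_assoc, Rinv_r, Rmult_1_l in H by lra.
Qed.

Lemma norm_plus_le {V : NormedModule C_AbsRing} (x y : V) :
  norm (plus x y) <= norm x + norm y.
Proof. exact (norm_triangle x y). Qed.

Lemma norm_minus_le {V : NormedModule C_AbsRing} (x y : V) :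
  norm (minus x y) <= norm x + norm y.
Proof. unfold minus. rewrite <- (norm_opp y). apply (norm_triangle x (opp y)). Qed.

Lemma norm_minus_sym {V : NormedModule C_AbsRing} (x y : V) :
  norm (minus x y) = norm (minus y x).
Proof. rewrite <- (norm_opp (minus x y)). f_equal. vec. Qed.

Lemma minus_eq_zero {V : NormedModule C_AbsRing} (x y : V) :
  minus x y = zero -> x = y.
Proof.
  intros H. transitivity (plus (minus x y) y); [vec|]. rewrite H. vec.
Qed.

(** [K] is an arbitrary constant independent of [eps]. *)
Lemma norm_small_eq_zero {V : NormedModule C_AbsRing} (x : V) (K : R) :
  (forall eps, 0 < eps -> norm x <= K * eps) -> x = zero.
Proof.
  intros H. apply norm_eq_zero.
  assert (H0 := norm_ge_0 x).
  destruct (Rle_lt_or_eq_dec _ _ H0) as [Hp|He]; [|now symmetry].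
  exfalso.
  assert (HK : 0 < Rabs K + 1) by (pose proof (Rabs_pos K); lra).
  specialize (H (norm x / (2 * (Rabs K + 1)))).
  assert (Hq : 0 < norm x / (2 * (Rabs K + 1))) by (apply Rdiv_lt_0_compat; lra).
  specialize (H Hq).
  assert (norm x = 2 * (Rabs K + 1) * (norm x / (2 * (Rabs K + 1)))) by (field; lra).
  set (q := norm x / (2 * (Rabs K + 1))) in *.
  pose proof (Rle_abs K). nra.
Qed.

Lemma is_linear_intro {V W : NormedModule C_AbsRing} (l : V -> W) (K : R) :
  (forall x y, l (plus x y) = plus (l x) (l y)) ->
  (forall (k : C) x, l (scal (k : C_AbsRing) x) = scal (k : C_AbsRing) (l x)) ->
  (forall x, norm (l x) <= K * norm x) -> is_linear l.
Proof.
  intros Hp Hs HK. split; [exact Hp|exact Hs|].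
  exists (Rabs K + 1). split; [pose proof (Rabs_pos K); lra|].
  intros x. specialize (HK x). pose proof (norm_ge_0 x). pose proof (Rle_abs K). nra.
Qed.

Lemma is_linear_minus {V W : NormedModule C_AbsRing} (S T : V -> W) :
  is_linear S -> is_linear T -> is_linear (fun x => minus (S x) (T x)).
Proof.
  intros hS hT.
  destruct (linear_norm _ hS) as [a [Ha HS]]. destruct (linear_norm _ hT) as [b [Hb HT]].
  apply (is_linear_intro _ (a + b)).
  - intros x y. rewrite (linear_plus _ hS), (linear_plus _ hT). vec.
  - intros k x. rewrite (linear_scal _ hS), (linear_scal _ hT). vec.
  - intros x. specialize (HS x). specialize (HT x).
    pose proof (norm_minus_le (S x) (T x)). nra.
Qed.

Lemma is_linear_scal {V W : NormedModule C_AbsRing} (c : C) (T : V -> W) :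
  is_linear T -> is_linear (fun x => scal (c : C_AbsRing) (T x)).
Proof.
  intros hT. destruct (linear_norm _ hT) as [b [Hb HT]].
  apply (is_linear_intro _ (Cmod c * b)).
  - intros x y. rewrite (linear_plus _ hT). vec.
  - intros k x. rewrite (linear_scal _ hT). vec.
  - intros x. specialize (HT x). pose proof (norm_scal_C c (T x)).
    pose proof (Cmod_ge_0 c). nra.
Qed.

Lemma is_linear_add {V W : NormedModule C_AbsRing} (S T : V -> W) :
  is_linear S -> is_linear T -> is_linear (fun x => plus (S x) (T x)).
Proof.
  intros hS hT.
  apply (is_linear_ext (fun x => minus (S x) (scal (RtoC (-1) : C_AbsRing) (T x)))).
  - intros x. vec.
  - apply is_linear_minus; [exact hS|]. now apply is_linear_scal.
Qed.

(** A bounded below surjective operator has a bounded inverse. *)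
Lemma invertible_of_bijective {V : NormedModule C_AbsRing} (T : V -> V) (K : R) :
  is_linear T -> (forall x, norm x <= K * norm (T x)) -> (forall y, exists x, T x = y) ->
  invertible T.
Proof.
  intros hT HK Hs. destruct (functional_choice _ Hs) as [S HS].
  assert (Hinj : forall x y, T x = T y -> x = y).
  { intros x y H. apply minus_eq_zero, norm_eq_zero.
    assert (H1 := HK (minus x y)). rewrite (linear_minus _ _ _ hT), H in H1.
    replace (minus (T y) (T y)) with (zero : V) in H1 by vec.
    rewrite norm_zero in H1. pose proof (norm_ge_0 (minus x y)). lra. }
  exists S. split; [|split].
  - apply (is_linear_intro _ K).
    + intros x y. apply Hinj. now rewrite (linear_plus _ hT), !HS.
    + intros k x. apply Hinj. now rewrite (linear_scal _ hT), !HS.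
    + intros x. rewrite <- (HS x) at 2. apply HK.
  - intros x. apply Hinj. apply HS.
  - exact HS.
Qed.

(** [sq T m] is the power of [T] of exponent [2 ^ m]. *)
Fixpoint sq {V : Type} (T : V -> V) (m : nat) : V -> V :=
  match m with
  | O => T
  | S m => fun x => sq T m (sq T m x)
  end.

Lemma sq_linear {V : NormedModule C_AbsRing} (T : V -> V) (m : nat) :
  is_linear T -> is_linear (sq T m).
Proof.
  intros hT. induction m as [|m IH]; [exact hT|]. simpl.
  now apply (is_linear_comp (sq T m) (sq T m)).
Qed.

(** An intertwining relation passes to powers. *)
Lemma sq_intertwine {V W : Type} (T : V -> V) (U : W -> W) (f : V -> W) :
  (forall x, f (T x) = U (f x)) -> forall m x, f (sq T m x) = sq U m (f x).
Proof.
  intros H m. induction m as [|m IH]; intros x; simpl; [apply H|]. now rewrite !IH.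
Qed.

Lemma sq_comm {V : Type} (T U : V -> V) :
  (forall x, T (U x) = U (T x)) -> forall m x, sq T m (U x) = U (sq T m x).
Proof. intros H m x. symmetry. apply sq_intertwine. intros y. symmetry. apply H. Qed.

Lemma sq_iter {V : Type} (T : V -> V) (m : nat) :
  forall x, sq T m x = Nat.iter (2 ^ m) T x.
Proof.
  induction m as [|m IH]; intros x; simpl; [reflexivity|].
  now rewrite !IH, Nat.add_0_r, Nat.iter_add.
Qed.

Lemma sq_bound {V : NormedModule C_AbsRing} (T : V -> V) (K : R) :
  0 <= K -> (forall x, norm (T x) <= K * norm x) ->
  forall m x, norm (sq T m x) <= K ^ (2 ^ m) * norm x.
Proof.
  intros HK HT m. induction m as [|m IH]; intros x.
  - simpl. rewrite Rmult_1_r. apply HT.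
  - simpl. rewrite Nat.add_0_r, pow_add.
    eapply Rle_trans; [apply IH|]. rewrite Rmult_assoc.
    apply Rmult_le_compat_l; [now apply pow_le|apply IH].
Qed.

Lemma pow_sq (r : R) (m : nat) : r ^ (2 ^ S m) = r ^ (2 ^ m) * r ^ (2 ^ m).
Proof. simpl. now rewrite Nat.add_0_r, pow_add. Qed.

Lemma Cpow_sq (r : C) (m : nat) : Cpow r (2 ^ S m) = Cmult (Cpow r (2 ^ m)) (Cpow r (2 ^ m)).
Proof. simpl. now rewrite Nat.add_0_r, Cpow_add_r. Qed.

Lemma pow_lt_incr (x y : R) (n : nat) : 0 < x < y -> (0 < n)%nat -> x ^ n < y ^ n.
Proof.
  intros Hxy Hn. destruct n as [|n]; [lia|]. clear Hn. simpl.
  assert (0 < x ^ n) by (apply pow_lt; lra).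
  assert (x ^ n <= y ^ n) by (apply pow_incr; lra). nra.
Qed.

Lemma pow_sq_small (q eps : R) :
  0 <= q < 1 -> 0 < eps -> exists m0, forall m, (m0 <= m)%nat -> q ^ (2 ^ m) <= eps.
Proof.
  intros Hq He. destruct (pow_lt_1_zero q) with (y := eps) as [N HN].
  - rewrite Rabs_pos_eq; lra.
  - exact He.
  - exists N. intros m Hm.
    assert (Hn : (N <= 2 ^ m)%nat) by (pose proof (Nat.pow_gt_lin_r 2 m); lia).
    specialize (HN _ Hn). pose proof (Rle_abs (q ^ (2 ^ m))). lra.
Qed.

Lemma Csqrt_exists (c : C) : exists d : C, Cmult d d = c.
Proof.
  destruct c as [a b].
  set (r := sqrt (a * a + b * b)).
  assert (Hr : r * r = a * a + b * b) by (apply sqrt_sqrt; nra).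
  assert (Hr0 : 0 <= r) by apply sqrt_pos.
  assert (Ha : 0 <= (r + a) / 2) by nra.
  assert (Hb : 0 <= (r - a) / 2) by nra.
  assert (E1 := sqrt_sqrt _ Ha). assert (E2 := sqrt_sqrt _ Hb).
  assert (P1 := sqrt_pos ((r + a) / 2)). assert (P2 := sqrt_pos ((r - a) / 2)).
  set (p := sqrt ((r + a) / 2)) in *. set (q := sqrt ((r - a) / 2)) in *.
  (* the imaginary part has absolute value [2 p q]; its sign is that of [b] *)
  assert (Hpq : (2 * (p * q)) * (2 * (p * q)) = b * b).
  { replace ((2 * (p * q)) * (2 * (p * q))) with (4 * (p * p) * (q * q)) by ring.
    rewrite E1, E2. nra. }
  assert (H0 : 0 <= p * q) by nra.
  destruct (Rle_dec 0 b) as [B|B].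
  - exists (p, q). unfold Cmult; simpl. f_equal; nra.
  - exists (p, - q). unfold Cmult; simpl. f_equal; nra.
Qed.

(** * Completeness and the Neumann series *)

(** Every norm-Cauchy sequence has a limit in norm. *)
Definition seq_complete (V : NormedModule C_AbsRing) : Prop :=
  forall u : nat -> V,
    (forall eps, 0 < eps -> exists N, forall n m, (N <= n)%nat -> (N <= m)%nat ->
       norm (minus (u n) (u m)) < eps) ->
    exists l : V, forall eps, 0 < eps -> exists N, forall n, (N <= n)%nat ->
       norm (minus (u n) l) < eps.

Lemma seq_complete_CompleteNormedModule (V : CompleteNormedModule C_AbsRing) :
  seq_complete V.
Proof.
  intros u Hu. set (F := filtermap u eventually).
  assert (HF : ProperFilter F) by (apply filtermap_proper_filter; apply eventually_filter).
  assert (Hc : cauchy F).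
  { intros eps. destruct (Hu eps (cond_pos eps)) as [N HN].
    exists (u N), N. intros n Hn. apply norm_compat1. apply HN; auto. }
  exists (lim F). intros eps He.
  assert (Hf := norm_factor_gt_0 (V := V)).
  assert (Hd : 0 < eps / norm_factor (V := V)) by now apply Rdiv_lt_0_compat.
  destruct (complete_cauchy F HF Hc (mkposreal _ Hd)) as [N HN].
  exists N. intros n Hn. specialize (HN n Hn).
  replace eps with (norm_factor (V := V) * (eps / norm_factor (V := V))) by (field; lra).
  exact (norm_compat2 _ _ _ HN).
Qed.

Lemma neumann_bound {V : NormedModule C_AbsRing} (T : V -> V) :
  (forall x, 2 * norm (T x) <= norm x) -> forall x, norm x <= 2 * norm (minus x (T x)).
Proof.
  intros HT x. specialize (HT x).
  assert (H : norm x <= norm (minus x (T x)) + norm (T x)).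
  { replace x with (plus (minus x (T x)) (T x)) at 1 by vec. apply norm_plus_le. }
  lra.
Qed.

Lemma neumann_onto {V : NormedModule C_AbsRing} (T : V -> V) :
  seq_complete V -> is_linear T -> (forall x, 2 * norm (T x) <= norm x) ->
  forall y : V, exists x : V, minus x (T x) = y.
Proof.
  intros hV hT HT y.
  set (u := fun n => Nat.iter n (fun x : V => plus y (T x)) y).
  assert (Hu : forall n, u (S n) = plus y (T (u n))) by reflexivity.
  assert (Hb : forall n, norm (u n) <= 2 * norm y).
  { induction n as [|n IH].
    - change (u O) with y. pose proof (norm_ge_0 y). lra.
    - rewrite Hu. pose proof (norm_plus_le y (T (u n))). specialize (HT (u n)). lra. }
  (* the iteration contracts by 1/2, and its distance to [u 0] is at most [3 |y|] *)
  assert (Hd : forall n k, norm (minus (u (n + k)%nat) (u n)) <= (/ 2) ^ n * (3 * norm y)).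
  { induction n as [|n IH]; intros k.
    - simpl. pose proof (norm_minus_le (u k) (u O)). pose proof (Hb k).
      change (u O) with y in *. lra.
    - simpl (S n + k)%nat. rewrite !Hu.
      replace (minus (plus y (T (u (n + k)%nat))) (plus y (T (u n))))
        with (T (minus (u (n + k)%nat) (u n))) by (rewrite (linear_minus _ _ _ hT); vec).
      specialize (IH k). specialize (HT (minus (u (n + k)%nat) (u n))). simpl. lra. }
  assert (Hc : forall eps, 0 < eps -> exists N, forall n, (N <= n)%nat ->
      (/ 2) ^ n * (3 * norm y) < eps).
  { intros eps He. pose proof (norm_ge_0 y) as Hy.
    destruct (pow_lt_1_zero (/ 2)) with (y := eps / (3 * norm y + 1)) as [N HN].
    - rewrite Rabs_pos_eq; lra.
    - apply Rdiv_lt_0_compat; lra.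
    - exists N. intros n Hn. specialize (HN n Hn).
      rewrite Rabs_pos_eq in HN by (apply pow_le; lra).
      assert (E : eps = eps / (3 * norm y + 1) * (3 * norm y + 1)) by (field; lra).
      rewrite E at 1. assert (0 < (/ 2) ^ n) by (apply pow_lt; lra). nra. }
  destruct (hV u) as [l Hl].
  { intros eps He. destruct (Hc (eps / 2)) as [N HN]; [lra|].
    exists N. intros n m Hn Hm.
    assert (A1 := Hd N (n - N)%nat). assert (A2 := Hd N (m - N)%nat).
    replace (N + (n - N))%nat with n in A1 by lia.
    replace (N + (m - N))%nat with m in A2 by lia.
    specialize (HN N (Nat.le_refl N)).
    replace (minus (u n) (u m)) with (minus (minus (u n) (u N)) (minus (u m) (u N))) by vec.
    pose proof (norm_minus_le (minus (u n) (u N)) (minus (u m) (u N))). lra. }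
  exists l. apply minus_eq_zero. apply (norm_small_eq_zero _ 2). intros eps He.
  destruct (Hl eps He) as [N HN].
  assert (A1 := HN N (Nat.le_refl N)). assert (A2 := HN (S N) (Nat.le_succ_diag_r N)).
  rewrite Hu in A2.
  replace (minus (minus l (T l)) y)
    with (minus (T (minus (u N) l)) (minus (plus y (T (u N))) l))
    by (rewrite (linear_minus _ _ _ hT); vec).
  pose proof (norm_minus_le (T (minus (u N) l)) (minus (plus y (T (u N))) l)).
  specialize (HT (minus (u N) l)). lra.
Qed.

Lemma neumann_invertible {V : NormedModule C_AbsRing} (T : V -> V) :
  seq_complete V -> is_linear T -> (forall x, 2 * norm (T x) <= norm x) ->
  invertible (fun x => minus x (T x)).
Proof.
  intros hV hT HT. apply (invertible_of_bijective _ 2).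
  - apply is_linear_minus; [apply is_linear_id|exact hT].
  - now apply neumann_bound.
  - now apply neumann_onto.
Qed.

(** * Topological nilpotence *)

(** The norms of the powers [T ^ (2 ^ m)] decrease faster than any geometric
    sequence, i.e. the spectral radius computed along these powers is zero. *)
Definition top_nilpotent {V : NormedModule C_AbsRing} (T : V -> V) : Prop :=
  forall r eps, 0 <= r -> 0 < eps -> exists m0, forall m, (m0 <= m)%nat ->
    forall x, r ^ (2 ^ m) * norm (sq T m x) <= eps * norm x.

Lemma invertible_bounded_below {V : NormedModule C_AbsRing} (T : V -> V) :
  invertible T -> exists K, 0 < K /\ forall x, norm x <= K * norm (T x).
Proof.
  intros [S [hS [H1 H2]]]. destruct (linear_norm _ hS) as [K [HK HS]].
  exists K. split; [exact HK|]. intros x. rewrite <- (H1 x) at 1. apply HS.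
Qed.

Lemma invertible_ext {V : NormedModule C_AbsRing} (T U : V -> V) :
  (forall x, T x = U x) -> invertible T -> invertible U.
Proof.
  intros H [S [hS [H1 H2]]]. exists S. split; [exact hS|].
  split; intros x; rewrite <- H; auto.
Qed.

Lemma invertible_scal {V : NormedModule C_AbsRing} (c : C) (T : V -> V) :
  c <> RtoC 0 -> is_linear T -> invertible T ->
  invertible (fun x => scal (c : C_AbsRing) (T x)).
Proof.
  intros Hc hT [S [hS [H1 H2]]].
  exists (fun x => scal (Cinv c : C_AbsRing) (S x)).
  split; [|split].
  - now apply is_linear_scal.
  - intros x. rewrite (linear_scal _ hS), H1. vec. now field.
  - intros x. rewrite (linear_scal _ hT), H2. vec. now field.
Qed.

(** [resol T mu] is the operator [I - mu T]. *)
Definition resol {V : NormedModule C_AbsRing} (T : V -> V) (mu : C) : V -> V :=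
  fun x => minus x (scal (mu : C_AbsRing) (T x)).

Lemma resol_linear {V : NormedModule C_AbsRing} (T : V -> V) (mu : C) :
  is_linear T -> is_linear (resol T mu).
Proof.
  intros hT. apply is_linear_minus; [apply is_linear_id|]. now apply is_linear_scal.
Qed.

Lemma shift_linear {V : NormedModule C_AbsRing} (T : V -> V) (l : C) :
  is_linear T -> is_linear (shift T l).
Proof.
  intros hT. apply is_linear_minus; [exact hT|]. apply is_linear_scal, is_linear_id.
Qed.

Lemma shift_resol {V : NormedModule C_AbsRing} (T : V -> V) (l : C) :
  l <> RtoC 0 ->
  forall x, shift T l x = scal (Copp l : C_AbsRing) (resol T (Cinv l) x).
Proof. intros Hl x. unfold shift, resol. vec. now field. Qed.


(** [(I - mu T) (I + mu T) = I - mu ^ 2 T ^ 2]: if the right-hand side is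
    invertible then so are the factors on the left. *)
Lemma resol_invertible_of_square {V : NormedModule C_AbsRing} (T : V -> V) (mu : C) :
  is_linear T -> invertible (resol (fun x => T (T x)) (Cmult mu mu)) ->
  invertible (resol T mu).
Proof.
  intros hT Hi. destruct Hi as [G [hG [H1 H2]]].
  set (F := fun x => plus x (scal (mu : C_AbsRing) (T x))).
  assert (hF : is_linear F).
  { apply is_linear_add; [apply is_linear_id|]. now apply is_linear_scal. }
  assert (E1 : forall x, resol T mu (F x) = resol (fun x => T (T x)) (Cmult mu mu) x).
  { intros x. unfold resol, F.
    rewrite (linear_plus _ hT), (linear_scal _ hT). vec. }
  assert (E2 : forall x, F (resol T mu x) = resol (fun x => T (T x)) (Cmult mu mu) x).
  { intros x. unfold resol, F.
    rewrite (linear_minus _ _ _ hT), (linear_scal _ hT). vec. }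
  assert (E3 : forall x, G (F (resol T mu x)) = x) by (intros x; now rewrite E2).
  assert (E4 : forall x, resol T mu (F (G x)) = x) by (intros x; now rewrite E1).
  exists (fun x => F (G x)).
  assert (E5 : forall x, G (F x) = F (G x)).
  { intros x. rewrite <- (E4 x) at 1. apply E3. }
  split; [now apply (is_linear_comp G F)|]. split; [|exact E4].
  intros x. rewrite <- E5. apply E3.
Qed.

Lemma resol_invertible_of_sq {V : NormedModule C_AbsRing} (T : V -> V) (mu : C) (m : nat) :
  is_linear T -> invertible (resol (sq T m) (Cpow mu (2 ^ m))) -> invertible (resol T mu).
Proof.
  intros hT. induction m as [|m IH]; intros H.
  - simpl in H. replace (Cmult mu (RtoC 1)) with mu in H by ring. exact H.
  - apply IH. rewrite Cpow_sq in H.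
    apply resol_invertible_of_square; [now apply sq_linear|exact H].
Qed.

Lemma top_nilpotent_resol {V : NormedModule C_AbsRing} (T : V -> V) (mu : C) :
  seq_complete V -> is_linear T -> top_nilpotent T -> invertible (resol T mu).
Proof.
  intros hV hT HT.
  destruct (HT (Cmod mu) (/ 2) (Cmod_ge_0 mu)) as [m Hm]; [lra|].
  apply (resol_invertible_of_sq T mu m hT).
  apply (neumann_invertible (fun x => scal (Cpow mu (2 ^ m) : C_AbsRing) (sq T m x))).
  - exact hV.
  - apply is_linear_scal. now apply sq_linear.
  - intros x. specialize (Hm m (Nat.le_refl m) x).
    rewrite norm_scal_C_eq, Cmod_pow. lra.
Qed.

Lemma top_nilpotent_quasinilpotent {V : NormedModule C_AbsRing} (T : V -> V) :
  seq_complete V -> is_linear T -> top_nilpotent T -> quasinilpotent T.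
Proof.
  intros hV hT HT l Hl.
  apply (invertible_ext (fun x => scal (Copp l : C_AbsRing) (resol T (Cinv l) x))).
  - intros x. symmetry. now apply shift_resol.
  - apply invertible_scal.
    + intros E. apply Hl. replace l with (Copp (Copp l)) by ring. rewrite E. ring.
    + now apply resol_linear.
    + now apply top_nilpotent_resol.
Qed.

Lemma quasinilpotent_resol {V : NormedModule C_AbsRing} (T : V -> V) (mu : C) :
  is_linear T -> quasinilpotent T -> invertible (resol T mu).
Proof.
  intros hT H. destruct (Ceq_dec mu (RtoC 0)) as [->|Hmu].
  - exists (fun x => x). split; [apply is_linear_id|].
    split; intros x; unfold resol; rewrite scal_C0; vec.
  - assert (Hi : Cinv mu <> RtoC 0).
    { intros E. apply C1_nz. rewrite <- (Cinv_r mu Hmu), E. ring. }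
    apply (invertible_ext (fun x => scal (Copp mu : C_AbsRing) (shift T (Cinv mu) x))).
    + intros x. unfold shift, resol. vec. now field.
    + apply invertible_scal.
      * intros E. apply Hmu. replace mu with (Copp (Copp mu)) by ring. rewrite E. ring.
      * now apply shift_linear.
      * now apply H.
Qed.

(** * Quasinilpotent operators are topologically nilpotent *)

(** On a compact disc the inverses of [I - mu T] are bounded uniformly. *)
Lemma resol_uniform_bound {V : NormedModule C_AbsRing} (T : V -> V) (R0 : R) :
  is_linear T -> (forall mu, invertible (resol T mu)) ->
  exists K, 0 < K /\
    forall mu, Cmod mu <= R0 -> forall x, norm x <= K * norm (resol T mu x).
Proof.
  intros hT Hinv.
  destruct (linear_norm _ hT) as [q [Hq HT]].
  assert (H1 : forall mu, exists K, 0 < K /\ forall x, norm x <= K * norm (resol T mu x)).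
  { intros mu. apply invertible_bounded_below, Hinv. }
  destruct (functional_choice _ H1) as [f Hf].
  (* within this radius (for each coordinate) of a point [mu] the bound valid at [mu]
     at most doubles *)
  assert (Hd0 : forall mu, 0 < / (4 * f mu * q)).
  { intros mu. destruct (Hf mu) as [Hp _]. apply Rinv_0_lt_compat. nra. }
  destruct (compactness_value_2d (- R0) R0 (- R0) R0
              (fun u v => mkposreal _ (Hd0 (u, v)))) as [d Hd].
  exists (/ (2 * d * q)).
  pose proof (cond_pos d) as Hdp.
  split; [apply Rinv_0_lt_compat; nra|].
  intros [a b] Hmu x. apply NNPP. intros N.
  assert (Hmax := Rle_trans _ _ _ (Rmax_Cmod (a, b)) Hmu). simpl in Hmax.
  assert (Ha : Rabs a <= R0) by (eapply Rle_trans; [apply Rmax_l|apply Hmax]).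
  assert (Hb : Rabs b <= R0) by (eapply Rle_trans; [apply Rmax_r|apply Hmax]).
  apply Rabs_le_between in Ha. apply Rabs_le_between in Hb.
  apply (Hd a b Ha Hb). intros [u [v [_ [_ [Hu [Hv Hdd]]]]]]. apply N. clear N.
  simpl in Hu, Hv, Hdd.
  destruct (Hf (u, v)) as [HK Hb2]. set (K := f (u, v)) in *.
  set (e := / (4 * K * q)) in *.
  assert (He : 4 * K * q * e = 1) by (apply Rinv_r; nra).
  assert (Hep : 0 < e) by (apply Rinv_0_lt_compat; nra).
  assert (Hc : Cmod (Cminus (a, b) (u, v)) <= 2 * e).
  { eapply Rle_trans; [apply Cmod_2Rmax|].
    change (sqrt 2 * Rmax (Rabs (a - u)) (Rabs (b - v)) <= 2 * e).
    assert (Hs := sqrt_sqrt 2 ltac:(lra)). pose proof (sqrt_pos 2).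
    assert (sqrt 2 <= 2) by nra.
    assert (Hm : Rmax (Rabs (a - u)) (Rabs (b - v)) <= e) by (apply Rmax_lub; lra).
    pose proof (Rmax_l (Rabs (a - u)) (Rabs (b - v))). pose proof (Rabs_pos (a - u)).
    nra. }
  assert (Hx := Hb2 x).
  assert (Hr : norm (resol T (u, v) x)
               <= norm (resol T (a, b) x) + 2 * e * (q * norm x)).
  { replace (resol T (u, v) x)
      with (plus (resol T (a, b) x) (scal (Cminus (a, b) (u, v) : C_AbsRing) (T x)))
      by (unfold resol; vec).
    eapply Rle_trans; [apply norm_plus_le|]. apply Rplus_le_compat_l.
    eapply Rle_trans; [apply norm_scal_C|].
    apply Rmult_le_compat; [apply Cmod_ge_0|apply norm_ge_0|exact Hc|apply HT]. }
  assert (H2 : norm x <= 2 * K * norm (resol T (a, b) x)).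
  { pose proof (norm_ge_0 x).
    assert (K * norm (resol T (u, v) x)
            <= K * norm (resol T (a, b) x) + / 2 * norm x).
    { eapply Rle_trans; [apply Rmult_le_compat_l, Hr; lra|].
      replace (/ 2) with (/ 2 * (4 * K * q * e)) by (rewrite He; ring). lra. }
    lra. }
  eapply Rle_trans; [exact H2|]. apply Rmult_le_compat_r; [apply norm_ge_0|].
  assert (Hi : 2 * d * q * / (2 * d * q) = 1) by (apply Rinv_r; nra).
  assert (Hip : 0 < / (2 * d * q)) by (apply Rinv_0_lt_compat; nra).
  set (i := / (2 * d * q)) in *.
  assert (2 * K * (2 * d * q) <= 1) by nra.
  nra.
Qed.

(** [G] is a bounded two-sided inverse of [T]. *)
Definition inverse_of {V : NormedModule C_AbsRing} (T G : V -> V) : Prop :=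
  is_linear G /\ (forall x, G (T x) = x) /\ (forall x, T (G x) = x).

Lemma inverse_of_unique {V : NormedModule C_AbsRing} (T G G' : V -> V) :
  inverse_of T G -> inverse_of T G' -> forall x, G x = G' x.
Proof.
  intros [_ [H1 _]] [_ [_ H2]] x. rewrite <- (H2 x) at 1. apply H1.
Qed.

Lemma C2_nz : RtoC 2 <> RtoC 0.
Proof. intros H. apply RtoC_inj in H. lra. Qed.

(** The inverse of [I - d ^ 2 T ^ 2] is the average of those of [I - d T] and
    [I + d T]. *)
Lemma inverse_of_resol_square {V : NormedModule C_AbsRing} (T G G' : V -> V) (d : C) :
  is_linear T -> inverse_of (resol T d) G -> inverse_of (resol T (Copp d)) G' ->
  inverse_of (resol (fun x => T (T x)) (Cmult d d))
    (fun x => scal (Cinv (RtoC 2) : C_AbsRing) (plus (G x) (G' x))).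
Proof.
  intros hT [hG [G1 G2]] [hG' [G1' G2']].
  assert (E1 : forall x, resol (fun x => T (T x)) (Cmult d d) x
                         = resol T d (resol T (Copp d) x)).
  { intros x. unfold resol. rewrite (linear_minus _ _ _ hT), (linear_scal _ hT). vec. }
  assert (E2 : forall x, resol (fun x => T (T x)) (Cmult d d) x
                         = resol T (Copp d) (resol T d x)).
  { intros x. unfold resol. rewrite (linear_minus _ _ _ hT), (linear_scal _ hT). vec. }
  assert (H2 : RtoC 2 <> RtoC 0) by (exact C2_nz).
  assert (E3 : forall x, x = scal (Cinv (RtoC 2) : C_AbsRing)
                               (plus (resol T (Copp d) x) (resol T d x))).
  { intros x. unfold resol. vec; now field. }
  assert (hF : is_linear (resol (fun x => T (T x)) (Cmult d d))).
  { apply resol_linear. now apply (is_linear_comp T T). }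
  split; [|split].
  - now apply is_linear_scal, is_linear_add.
  - intros x. rewrite E1 at 1. rewrite E2, G1, G1'. symmetry. apply E3.
  - intros x. rewrite (linear_scal _ hF), (linear_plus _ hF), E2, E1, G2, G2'.
    symmetry. apply E3.
Qed.

(** On each ray from the origin, the inverses of [I - mu T] at the points of
    moduli [s] and [s'] differ by at most [eta]. *)
Definition resol_close {V : NormedModule C_AbsRing} (T : V -> V) (s s' eta : R) : Prop :=
  forall (u : C) (G G' : V -> V), Cmod u = 1 ->
    inverse_of (resol T (Cmult (RtoC s) u)) G ->
    inverse_of (resol T (Cmult (RtoC s') u)) G' ->
    forall x, norm (minus (G x) (G' x)) <= eta * norm x.

Lemma resol_close_square {V : NormedModule C_AbsRing} (T : V -> V) (s s' eta : R) :
  is_linear T -> (forall mu, invertible (resol T mu)) -> resol_close T s s' eta ->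
  (forall mu, invertible (resol (fun x => T (T x)) mu)) /\
  resol_close (fun x => T (T x)) (s * s) (s' * s') eta.
Proof.
  intros hT Hinv Hcl. split.
  - intros mu. destruct (Csqrt_exists mu) as [d <-].
    destruct (Hinv d) as [G HG]. destruct (Hinv (Copp d)) as [G' HG'].
    eexists. exact (inverse_of_resol_square T G G' d hT HG HG').
  - intros u G G' Hu HG HG' x.
    destruct (Csqrt_exists u) as [d Hd].
    assert (Hmd : Cmod d = 1).
    { rewrite <- Hd, Cmod_mult in Hu. pose proof (Cmod_ge_0 d). nra. }
    assert (Hopp : forall t, Copp (Cmult (RtoC t) d) = Cmult (RtoC t) (Copp d))
      by (intros t; ring).
    assert (Hav : forall t F F1 F2, inverse_of (resol (fun x => T (T x)) (Cmult (RtoC (t * t)) u)) F ->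
       inverse_of (resol T (Cmult (RtoC t) d)) F1 ->
       inverse_of (resol T (Cmult (RtoC t) (Copp d))) F2 ->
       F x = scal (Cinv (RtoC 2) : C_AbsRing) (plus (F1 x) (F2 x))).
    { intros t F F1 F2 HF HF1 HF2. rewrite <- Hopp in HF2.
      assert (HI := inverse_of_resol_square T F1 F2 _ hT HF1 HF2).
      replace (Cmult (Cmult (RtoC t) d) (Cmult (RtoC t) d)) with (Cmult (RtoC (t * t)) u)
        in HI by (rewrite RtoC_mult, <- Hd; ring).
      exact (inverse_of_unique _ _ _ HF HI x). }
    destruct (Hinv (Cmult (RtoC s) d)) as [G1 HG1].
    destruct (Hinv (Cmult (RtoC s) (Copp d))) as [G2 HG2].
    destruct (Hinv (Cmult (RtoC s') d)) as [G1' HG1'].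
    destruct (Hinv (Cmult (RtoC s') (Copp d))) as [G2' HG2'].
    rewrite (Hav s G G1 G2 HG HG1 HG2), (Hav s' G' G1' G2' HG' HG1' HG2').
    assert (C1 := Hcl d G1 G1' Hmd HG1 HG1' x).
    assert (C2 := Hcl (Copp d) G2 G2' ltac:(now rewrite Cmod_opp) HG2 HG2' x).
    match goal with
    | |- norm ?e <= _ =>
      replace e with (scal (Cinv (RtoC 2) : C_AbsRing)
        (plus (minus (G1 x) (G1' x)) (minus (G2 x) (G2' x))) : V) by vec
    end.
    eapply Rle_trans; [apply norm_scal_C|].
    rewrite Cmod_inv, Cmod_R, (Rabs_pos_eq 2) by (first [lra | exact C2_nz]).
    eapply Rle_trans; [apply Rmult_le_compat_l; [lra|apply norm_plus_le]|]. lra.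
Qed.

Lemma resol_close_sq {V : NormedModule C_AbsRing} (T : V -> V) (s s' eta : R) :
  is_linear T -> (forall mu, invertible (resol T mu)) -> resol_close T s s' eta ->
  forall m, (forall mu, invertible (resol (sq T m) mu)) /\
            resol_close (sq T m) (s ^ (2 ^ m)) (s' ^ (2 ^ m)) eta.
Proof.
  intros hT Hinv Hcl m. induction m as [|m [IH1 IH2]].
  - simpl. rewrite !Rmult_1_r. now split.
  - rewrite !pow_sq. apply (resol_close_square (sq T m)); auto. now apply sq_linear.
Qed.

(** If [s T] is small then the inverse of [I - s T] is close to [I], hence so is that
    of [I - s' T], which bounds [s' T]. *)
Lemma resol_close_bootstrap {V : NormedModule C_AbsRing} (T : V -> V) (s s' : R) :
  is_linear T -> (forall mu, invertible (resol T mu)) ->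
  0 <= s -> 0 <= s' -> resol_close T s s' (/ 4) ->
  (forall x, s * norm (T x) <= / 8 * norm x) -> forall x, s' * norm (T x) <= norm x.
Proof.
  intros hT Hinv Hs Hs' Hcl H y.
  destruct (Hinv (Cmult (RtoC s) (RtoC 1))) as [G HG].
  destruct (Hinv (Cmult (RtoC s') (RtoC 1))) as [G' HG'].
  set (x := resol T (Cmult (RtoC s') (RtoC 1)) y).
  assert (Hc := Hcl (RtoC 1) G G' Cmod_1 HG HG' x).
  destruct HG as [_ [_ HG]]. destruct HG' as [_ [HG' _]].
  unfold x at 2 in Hc. rewrite HG' in Hc.
  specialize (HG x). set (z := G x) in *.
  assert (Hz := H z).
  assert (Nz : norm (scal (Cmult (RtoC s) (RtoC 1) : C_AbsRing) (T z)) = s * norm (T z)).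
  { rewrite norm_scal_C_eq, Cmod_mult, Cmod_1, Cmod_R, Rabs_pos_eq; lra. }
  assert (Ny : norm (scal (Cmult (RtoC s') (RtoC 1) : C_AbsRing) (T y)) = s' * norm (T y)).
  { rewrite norm_scal_C_eq, Cmod_mult, Cmod_1, Cmod_R, Rabs_pos_eq; lra. }
  assert (H1 : norm z <= norm x + s * norm (T z)).
  { rewrite <- Nz. replace z with (plus x (scal (Cmult (RtoC s) (RtoC 1) : C_AbsRing) (T z)))
      at 1 by (rewrite <- HG; unfold resol; vec). apply norm_plus_le. }
  assert (H2 : norm x <= norm y + s' * norm (T y)).
  { rewrite <- Ny. apply norm_minus_le. }
  assert (H3 : s' * norm (T y) <= norm (minus z y) + s * norm (T z)).
  { rewrite <- Ny, <- Nz.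
    replace (scal (Cmult (RtoC s') (RtoC 1) : C_AbsRing) (T y))
      with (minus (scal (Cmult (RtoC s) (RtoC 1) : C_AbsRing) (T z)) (minus z y)).
    - rewrite Rplus_comm. apply norm_minus_le.
    - transitivity (minus y (resol T (Cmult (RtoC s) (RtoC 1)) z)).
      + unfold resol. vec.
      + rewrite HG. unfold x, resol. vec. }
  pose proof (norm_ge_0 y). lra.
Qed.

Lemma resol_close_of_bound {V : NormedModule C_AbsRing} (T : V -> V) (R0 K q s s' : R) :
  is_linear T -> 0 < K -> 0 < q -> (forall x, norm (T x) <= q * norm x) ->
  (forall mu, Cmod mu <= R0 -> forall x, norm x <= K * norm (resol T mu x)) ->
  0 <= s <= R0 -> 0 <= s' <= R0 -> resol_close T s s' (K * (Rabs (s - s') * (q * K))).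
Proof.
  intros hT HKp Hqp Hq HK Hs Hs' u G G' Hu [hG [_ HG]] [_ [_ HG']] x.
  assert (Hm : forall t, 0 <= t <= R0 -> Cmod (Cmult (RtoC t) u) <= R0).
  { intros t Ht. rewrite Cmod_mult, Hu, Cmod_R, Rabs_pos_eq; lra. }
  (* second resolvent identity *)
  assert (E : resol T (Cmult (RtoC s) u) (minus (G x) (G' x))
              = scal (Cmult (RtoC (s - s')) u : C_AbsRing) (T (G' x))).
  { rewrite (linear_minus _ _ _ (resol_linear T _ hT)), HG.
    rewrite <- (HG' x) at 1. unfold resol. vec. rewrite RtoC_minus. ring. }
  eapply Rle_trans; [apply (HK _ (Hm s Hs))|]. rewrite E, Rmult_assoc.
  apply Rmult_le_compat_l; [lra|].
  rewrite norm_scal_C_eq, Cmod_mult, Hu, Cmod_R, Rmult_1_r, Rmult_assoc.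
  apply Rmult_le_compat_l; [apply Rabs_pos|].
  eapply Rle_trans; [apply Hq|]. rewrite Rmult_assoc. apply Rmult_le_compat_l; [lra|].
  rewrite <- (HG' x) at 2. apply (HK _ (Hm s' Hs')).
Qed.

(** The spectral radius formula for quasinilpotent operators.  If
    [s ^ n |T ^ n| -> 0] then the inverses of [I - s ^ n u T ^ n] tend to [I]; since
    averaging preserves the modulus of continuity of the resolvent, those of
    [I - s' ^ n u T ^ n] stay near [I] for all [s'] within a distance of [s] that
    does not depend on [s]. *)
Lemma quasinilpotent_top_nilpotent {V : NormedModule C_AbsRing} (T : V -> V) :
  is_linear T -> quasinilpotent T -> top_nilpotent T.
Proof.
  intros hT hQ.
  assert (Hinv : forall mu, invertible (resol T mu)) by (intros; now apply quasinilpotent_resol).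
  intros r eps Hr He. revert eps He.
  set (E := fun s => forall eps, 0 < eps -> exists m0, forall m, (m0 <= m)%nat ->
     forall x, s ^ (2 ^ m) * norm (sq T m x) <= eps * norm x).
  change (E r).
  destruct (linear_norm _ hT) as [q [Hqp Hq]].
  destruct (resol_uniform_bound T (r + 1) hT Hinv) as [K [HKp HK]].
  set (d := Rmin 1 (/ (4 * (K * (q * K))))).
  assert (Hpos : 0 < K * (q * K)) by (apply Rmult_lt_0_compat; nra).
  assert (Hd : 0 < d).
  { apply Rmin_glb_lt; [lra|]. apply Rinv_0_lt_compat. lra. }
  assert (Hd1 : d <= 1) by apply Rmin_l.
  assert (Hd2 : K * (d * (q * K)) <= / 4).
  { assert (H := Rmin_r 1 (/ (4 * (K * (q * K))))). fold d in H.
    assert (Hi : 4 * (K * (q * K)) * / (4 * (K * (q * K))) = 1) by (apply Rinv_r; lra).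
    set (i := / (4 * (K * (q * K)))) in *. nra. }
  assert (Hmono : forall s s', 0 <= s <= s' -> E s' -> E s).
  { intros s s' Hs Hs' eps He. destruct (Hs' eps He) as [m0 Hm0]. exists m0.
    intros m Hm x. eapply Rle_trans; [|apply (Hm0 m Hm x)].
    apply Rmult_le_compat_r; [apply norm_ge_0|]. now apply pow_incr. }
  assert (Hstep : forall s, 0 <= s <= r -> E s -> E (s + d / 2)).
  { intros s Hs HE eps He.
    destruct (HE (/ 8)) as [m0 Hm0]; [lra|].
    assert (Hden : 0 < s + d) by lra.
    set (rho := (s + d / 2) / (s + d)).
    assert (Hrho : rho * (s + d) = s + d / 2) by (unfold rho; field; lra).
    assert (Hrho1 : 0 <= rho < 1).
    { split; [apply Rlt_le, Rdiv_lt_0_compat; lra|].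
      apply (Rmult_lt_reg_r (s + d)); lra. }
    destruct (pow_sq_small rho eps Hrho1 He) as [m1 Hm1].
    exists (Nat.max m0 m1). intros m Hm x.
    specialize (Hm0 m ltac:(lia)). specialize (Hm1 m ltac:(lia)).
    assert (Hcl : resol_close T s (s + d) (/ 4)).
    { intros u G G' Hu HG HG' y.
      eapply Rle_trans;
        [apply (resol_close_of_bound T (r + 1) K q s (s + d) hT HKp Hqp Hq HK
                  ltac:(lra) ltac:(lra) u G G' Hu HG HG')|].
      apply Rmult_le_compat_r; [apply norm_ge_0|].
      replace (Rabs (s - (s + d))) with d; [exact Hd2|].
      rewrite Rabs_left1; lra. }
    destruct (resol_close_sq T s (s + d) (/ 4) hT Hinv Hcl m) as [Hinvm Hclm].
    assert (Hb := resol_close_bootstrap (sq T m) _ _ (sq_linear T m hT) Hinvm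
                    (pow_le s (2 ^ m) (proj1 Hs)) (pow_le (s + d) (2 ^ m) (Rlt_le _ _ Hden))
                    Hclm Hm0 x).
    rewrite <- Hrho, Rpow_mult_distr, Rmult_assoc.
    apply Rmult_le_compat; [apply pow_le; lra| |exact Hm1|exact Hb].
    apply Rmult_le_pos; [apply pow_le; lra|apply norm_ge_0]. }
  assert (H0 : E 0).
  { intros eps He. exists O. intros m _ x.
    rewrite pow_i by (pose proof (Nat.pow_gt_lin_r 2 m); lia).
    rewrite Rmult_0_l. pose proof (norm_ge_0 x). nra. }
  assert (Hall : forall j : nat, E (Rmin (INR j * (d / 2)) r)).
  { induction j as [|j IH].
    - simpl. rewrite Rmult_0_l, Rmin_left by lra. exact H0.
    - assert (Hj : 0 <= INR j * (d / 2)) by (apply Rmult_le_pos; [apply pos_INR|lra]).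
      apply (Hmono _ (Rmin (INR j * (d / 2)) r + d / 2)).
      + rewrite S_INR. unfold Rmin.
        destruct (Rle_dec (INR j * (d / 2)) r), (Rle_dec ((INR j + 1) * (d / 2)) r); lra.
      + apply Hstep; [|exact IH].
        split; [apply Rmin_glb; lra|apply Rmin_r]. }
  destruct (INR_unbounded (r / (d / 2))) as [j Hj].
  specialize (Hall j). rewrite Rmin_right in Hall; [exact Hall|].
  apply Rlt_le. apply (Rmult_lt_compat_r (d / 2)) in Hj; [|lra].
  replace (r / (d / 2) * (d / 2)) with r in Hj by (field; lra). exact Hj.
Qed.

(** * Commuting outer inverses *)

(** [S] is a bounded operator with [M S = S M] and [S M S = S]. *)
Definition commuting_outer_inverse {V : NormedModule C_AbsRing} (M S : V -> V) : Prop :=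
  is_linear S /\ (forall x, M (S x) = S (M x)) /\ (forall x, S (M (S x)) = S x).

(** The part [M S M - M] of [M] that [S] does not invert. *)
Definition defect {V : NormedModule C_AbsRing} (M S : V -> V) : V -> V :=
  fun x => minus (M (S (M x))) (M x).

(** The idempotent [P = I - S M]. *)
Definition coproj {V : NormedModule C_AbsRing} (M S : V -> V) : V -> V :=
  fun x => minus x (S (M x)).

Lemma defect_linear {V : NormedModule C_AbsRing} (M S : V -> V) :
  is_linear M -> is_linear S -> is_linear (defect M S).
Proof.
  intros hM hS. apply is_linear_minus; [|exact hM].
  apply (is_linear_comp (fun x => S (M x)) M); [|exact hM].
  now apply (is_linear_comp M S).
Qed.

Lemma coproj_linear {V : NormedModule C_AbsRing} (M S : V -> V) :
  is_linear M -> is_linear S -> is_linear (coproj M S).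
Proof.
  intros hM hS. apply is_linear_minus; [apply is_linear_id|].
  now apply (is_linear_comp M S).
Qed.

(** The powers of the defect take their values in the range of [P]. *)
Lemma coproj_sq_defect {V : NormedModule C_AbsRing} (M S : V -> V) (m : nat) :
  is_linear M -> commuting_outer_inverse M S ->
  forall x, coproj M S (sq (defect M S) m x) = sq (defect M S) m x.
Proof.
  intros hM [hS [Hc Ho]]. induction m as [|m IH]; intros x; [|apply IH].
  simpl. unfold coproj, defect.
  rewrite (linear_minus _ _ _ hM), (linear_minus _ _ _ hS).
  replace (S (M (M (S (M x))))) with (S (M (M x))); [vec|].
  now rewrite (Hc (M x)), Ho.
Qed.

(** On the range of [P] the powers of [M] are those of the defect.  The exponent has
    to be even because the defect is [- M P]. *)
Lemma sq_coproj {V : NormedModule C_AbsRing} (M S : V -> V) (m : nat) :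
  is_linear M -> commuting_outer_inverse M S -> (1 <= m)%nat ->
  forall x, sq M m (coproj M S x) = sq (defect M S) m x.
Proof.
  intros hM hO Hm. destruct m as [|m]; [lia|]. clear Hm.
  induction m as [|m IH]; intros x.
  - destruct hO as [hS [Hc Ho]]. simpl. unfold coproj, defect.
    rewrite !(linear_minus _ _ _ hM), !(linear_minus _ _ _ hS), !(linear_minus _ _ _ hM).
    assert (E1 : forall y, M (S (M (M y))) = M (M (S (M y)))).
    { intros y. now rewrite (Hc (M y)). }
    assert (E2 : M (S (M (M (S (M x))))) = M (M (S (M x)))).
    { rewrite E1, Ho. reflexivity. }
    rewrite E2, E1. vec.
  - change (sq M (Datatypes.S m) (sq M (Datatypes.S m) (coproj M S x)) =
            sq (defect M S) (Datatypes.S m) (sq (defect M S) (Datatypes.S m) x)).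
    rewrite IH, <- (coproj_sq_defect M S (Datatypes.S m) hM hO x), IH.
    now rewrite coproj_sq_defect.
Qed.

(** [S M] times [M ^ n S ^ n] is [S M] again. *)
Lemma sq_outer_inverse {V : NormedModule C_AbsRing} (M S : V -> V) (m : nat) :
  commuting_outer_inverse M S ->
  forall x, S (M (sq M m (sq S m x))) = S (M x).
Proof.
  intros [hS [Hc Ho]].
  assert (Hsm : forall k y, sq M k (S (M y)) = S (M (sq M k y))).
  { intros k. apply (sq_comm M (fun y => S (M y))). intros y. apply Hc. }
  induction m as [|m IH]; intros x; simpl.
  - now rewrite (Hc x), Ho.
  - rewrite <- Hsm, IH, Hsm. apply IH.
Qed.

(** [M ^ k S M = M ^ k] says that [M ^ k P = 0], so the defect is nilpotent. *)
Lemma drazin_defect_top_nilpotent {V : NormedModule C_AbsRing} (M S : V -> V) (k : nat) :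
  is_linear M -> commuting_outer_inverse M S ->
  (forall x, Nat.iter k M (S (M x)) = Nat.iter k M x) -> top_nilpotent (defect M S).
Proof.
  intros hM hO Hk r eps Hr He. exists (Datatypes.S k). intros m Hm x.
  assert (hI : forall n, is_linear (Nat.iter n M)).
  { induction n as [|n IH]; [apply is_linear_id|].
    now apply (is_linear_comp (Nat.iter n M) M). }
  assert (E : sq (defect M S) m x = zero).
  { rewrite <- sq_coproj by (assumption || lia). rewrite sq_iter.
    transitivity (Nat.iter ((2 ^ m - k) + k) M (coproj M S x)).
    - f_equal. pose proof (Nat.pow_gt_lin_r 2 m). lia.
    - rewrite Nat.iter_add. unfold coproj at 1.
      rewrite (linear_minus _ _ _ (hI k)), Hk.
      transitivity (Nat.iter (2 ^ m - k) M zero); [f_equal; vec|].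
      now apply linear_zero. }
  rewrite E, norm_zero, Rmult_0_r. pose proof (norm_ge_0 x). nra.
Qed.

(** For small nonzero [l], [M - l] is bounded below: on the range of [P] because the
    defect is quasinilpotent, on the range of [S M] because [I - l S] is. *)
Lemma shift_bounded_below {V : NormedModule C_AbsRing} (M S : V -> V) :
  is_linear M -> commuting_outer_inverse M S -> quasinilpotent (defect M S) ->
  exists t, 0 < t /\ forall l : C, l <> RtoC 0 -> Cmod l < t ->
    exists K, 0 < K /\ forall z, norm z <= K * norm (shift M l z).
Proof.
  intros hM [hS [Hc Ho]] hQ.
  destruct (linear_norm _ hS) as [a [Ha HS]].
  destruct (linear_norm _ (coproj_linear M S hM hS)) as [b [Hb HP]].
  exists (/ (2 * a)). split; [apply Rinv_0_lt_compat; lra|].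
  intros l Hl Hlt.
  assert (Hla : Cmod l * a <= / 2).
  { assert (E : 2 * a * / (2 * a) = 1) by (apply Rinv_r; lra).
    set (i := / (2 * a)) in *. nra. }
  assert (Hol : Copp l <> RtoC 0).
  { intros E. apply Hl. replace l with (Copp (Copp l)) by ring. rewrite E. ring. }
  destruct (invertible_bounded_below _ (hQ (Copp l) Hol)) as [K [HK HQ]].
  exists (K * b + 2 * a). split; [nra|]. intros z.
  assert (H1 : norm (coproj M S z) <= K * (b * norm (shift M l z))).
  { eapply Rle_trans; [apply HQ|]. apply Rmult_le_compat_l; [lra|].
    replace (shift (defect M S) (Copp l) (coproj M S z))
      with (opp (coproj M S (shift M l z)) : V).
    - rewrite norm_opp. apply HP.
    - unfold shift, coproj, defect.
      rewrite !(linear_minus _ _ _ hM), !(linear_minus _ _ _ hS), !(linear_minus _ _ _ hM).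
      rewrite !(linear_scal _ hM), !(linear_scal _ hS).
      rewrite Ho, (Hc (M z)). vec. }
  assert (H2 : norm (S (M z)) <= 2 * (a * norm (shift M l z))).
  { eapply Rle_trans.
    - apply (neumann_bound (fun x => scal (l : C_AbsRing) (S x))).
      intros x. rewrite norm_scal_C_eq. specialize (HS x).
      pose proof (Cmod_ge_0 l). pose proof (norm_ge_0 x). nra.
    - apply Rmult_le_compat_l; [lra|].
      replace (minus (S (M z)) (scal (l : C_AbsRing) (S (S (M z)))))
        with (S (shift M l z)); [apply HS|].
      unfold shift. rewrite (linear_minus _ _ _ hS), (linear_scal _ hS).
      now rewrite <- (Hc z), Ho. }
  replace z with (plus (coproj M S z) (S (M z))) at 1 by (unfold coproj; vec).
  eapply Rle_trans; [apply norm_plus_le|]. lra.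
Qed.

(** * Invariant subspaces *)

(** The subspace under consideration is the kernel of a bounded operator [p].  If it
    contains the preimages of its elements under [M - l] for all small [l <> 0], then
    also under [M ^ n - c], which is a product of such factors. *)
Lemma sq_shift_preimage {V W : NormedModule C_AbsRing} (p : V -> W) (M : V -> V) (e : R) :
  is_linear M -> 0 < e ->
  (forall l : C, l <> RtoC 0 -> Cmod l < e -> forall z, p (shift M l z) = zero -> p z = zero) ->
  forall m (c : C), c <> RtoC 0 -> Cmod c < e ^ (2 ^ m) ->
    forall z, p (shift (sq M m) c z) = zero -> p z = zero.
Proof.
  intros hM He Hp m. induction m as [|m IH]; intros c Hc Hlt z Hz.
  - simpl in Hlt. rewrite Rmult_1_r in Hlt. exact (Hp c Hc Hlt z Hz).
  - destruct (Csqrt_exists c) as [d <-].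
    assert (Hd : d <> RtoC 0) by (intros ->; apply Hc; ring).
    assert (Hod : Copp d <> RtoC 0).
    { intros E. apply Hd. replace d with (Copp (Copp d)) by ring. rewrite E. ring. }
    assert (Hdl : Cmod d < e ^ (2 ^ m)).
    { rewrite pow_sq, Cmod_mult in Hlt. pose proof (pow_lt e (2 ^ m) He).
      pose proof (Cmod_ge_0 d). nra. }
    assert (E : shift (sq M (S m)) (Cmult d d) z
                = shift (sq M m) d (shift (sq M m) (Copp d) z)).
    { pose proof (sq_linear M m hM) as hN. simpl. unfold shift.
      rewrite (linear_minus _ _ _ hN), (linear_scal _ hN). vec. }
    rewrite E in Hz.
    apply (IH (Copp d) Hod); [now rewrite Cmod_opp|].
    exact (IH d Hd Hdl _ Hz).
Qed.

(** The idempotent [S M] preserves the subspace: it is the limit of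
    [(M ^ n - r ^ n)^-1 M ^ n] for small [r > 0], since [S ^ n] is small compared with
    [r ^ -n] and the [n]-th power of the defect is small compared with [r ^ n]. *)
Lemma idempotent_invariant {V W : NormedModule C_AbsRing} (p : V -> W) (M S : V -> V) (e : R) :
  seq_complete V -> is_linear p -> is_linear M -> commuting_outer_inverse M S ->
  top_nilpotent (defect M S) -> 0 < e ->
  (forall z, p z = zero -> p (M z) = zero) ->
  (forall l : C, l <> RtoC 0 -> Cmod l < e -> forall z, p (shift M l z) = zero -> p z = zero) ->
  forall z, p z = zero -> p (S (M z)) = zero.
Proof.
  intros hV hp hM hO HQ He HpM Hp z Hz.
  pose proof hO as [hS [Hc Ho]].
  destruct (linear_norm _ hp) as [kp [Hkp Bp]].
  destruct (linear_norm _ hS) as [ks [Hks BS]].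
  destruct (linear_norm _ (is_linear_comp M S hM hS)) as [ke [Hke BE]].
  destruct (linear_norm _ (coproj_linear M S hM hS)) as [kc [Hkc BC]].
  set (r := Rmin (e / 2) (/ (2 * ks))).
  assert (Hr : 0 < r).
  { apply Rmin_glb_lt; [lra|]. apply Rinv_0_lt_compat. lra. }
  assert (Hre : r <= e / 2) by apply Rmin_l.
  assert (Hrs : 0 <= r * ks < 1).
  { assert (H := Rmin_r (e / 2) (/ (2 * ks))). fold r in H.
    assert (E : 2 * ks * / (2 * ks) = 1) by (apply Rinv_r; lra).
    set (i := / (2 * ks)) in *. split; nra. }
  apply (norm_small_eq_zero _ (kp * (ke * (2 * norm z) + kc * (2 * norm z)))).
  intros eta0 Heta0.
  set (eta := Rmin eta0 (/ 2)).
  assert (Heta : 0 < eta) by (apply Rmin_glb_lt; lra).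
  assert (Heta1 : eta <= eta0) by apply Rmin_l.
  assert (Heta2 : eta <= / 2) by apply Rmin_r.
  destruct (pow_sq_small (r * ks) eta Hrs Heta) as [m1 Hm1].
  destruct (HQ (/ r) eta (Rlt_le _ _ (Rinv_0_lt_compat _ Hr)) Heta) as [m2 Hm2].
  set (m := (1 + m1 + m2)%nat).
  specialize (Hm1 m ltac:(unfold m; lia)). specialize (Hm2 m ltac:(unfold m; lia)).
  assert (Hrm : 0 < r ^ (2 ^ m)) by now apply pow_lt.
  set (c := RtoC (r ^ (2 ^ m))).
  assert (Hc0 : c <> RtoC 0) by (intros E; apply RtoC_inj in E; lra).
  assert (Hcm : Cmod c = r ^ (2 ^ m)) by (unfold c; rewrite Cmod_R, Rabs_pos_eq; lra).
  assert (Hce : Cmod c < e ^ (2 ^ m)).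
  { rewrite Hcm. apply pow_lt_incr; [lra|]. pose proof (Nat.pow_gt_lin_r 2 m). lia. }
  set (N := sq M m). set (Sn := sq S m). set (Qn := sq (defect M S) m).
  assert (hN : is_linear N) by now apply sq_linear.
  assert (hSn : is_linear Sn) by now apply sq_linear.
  assert (hQn : is_linear Qn) by now apply sq_linear, defect_linear.
  assert (BSn : forall x, norm (scal (c : C_AbsRing) (Sn x)) <= eta * norm x).
  { intros x. rewrite norm_scal_C_eq, Hcm.
    assert (H := sq_bound S ks (Rlt_le _ _ Hks) BS m x). fold Sn in H.
    apply Rle_trans with (r ^ (2 ^ m) * (ks ^ (2 ^ m) * norm x)).
    - apply Rmult_le_compat_l; lra.
    - rewrite <- Rmult_assoc, <- Rpow_mult_distr.
      apply Rmult_le_compat_r; [apply norm_ge_0|exact Hm1]. }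
  assert (BQn : forall x, norm (scal (Cinv c : C_AbsRing) (Qn x)) <= eta * norm x).
  { intros x. rewrite norm_scal_C_eq, Cmod_inv, Hcm by exact Hc0.
    rewrite <- pow_inv. apply Hm2. }
  (* [w = S M b + P a] will be [(M ^ n - c)^-1 M ^ n z], where
     [b = (I - c S ^ n)^-1 z] and [P a = (Q ^ n - c)^-1 Q ^ n z] *)
  destruct (neumann_onto (fun x => scal (c : C_AbsRing) (Sn x)) hV) with (y := z) as [b Hb].
  { now apply is_linear_scal. }
  { intros x. specialize (BSn x). pose proof (norm_ge_0 x). nra. }
  assert (Nb := neumann_bound (fun x => scal (c : C_AbsRing) (Sn x))
                  ltac:(intros x; specialize (BSn x); pose proof (norm_ge_0 x); nra) b).
  cbv beta in Nb. rewrite Hb in Nb.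
  destruct (neumann_onto (fun x => scal (Cinv c : C_AbsRing) (Qn x)) hV)
    with (y := opp (scal (Cinv c : C_AbsRing) (Qn z)) : V) as [a Ha].
  { now apply is_linear_scal. }
  { intros x. specialize (BQn x). pose proof (norm_ge_0 x). nra. }
  assert (Na := neumann_bound (fun x => scal (Cinv c : C_AbsRing) (Qn x))
                  ltac:(intros x; specialize (BQn x); pose proof (norm_ge_0 x); nra) a).
  cbv beta in Na. rewrite Ha in Na.
  replace (norm (opp (scal (Cinv c : C_AbsRing) (Qn z))))
    with (norm (scal (Cinv c : C_AbsRing) (Qn z))) in Na by (symmetry; apply norm_opp).
  set (w := plus (S (M b)) (coproj M S a) : V).
  assert (HPQ : forall x, coproj M S (Qn x) = Qn x).
  { intros x. apply (coproj_sq_defect M S m hM hO). }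
  assert (HNP : forall x, N (coproj M S x) = Qn x).
  { intros x. apply (sq_coproj M S m hM hO). unfold m. lia. }
  assert (HNE : forall x, N (S (M x)) = S (M (N x))).
  { intros x. apply (sq_comm M (fun y => S (M y))). intros y. apply Hc. }
  assert (hP := coproj_linear M S hM hS).
  assert (Hw : shift N c w = N z).
  { assert (E1 : minus (Qn a) (scal (c : C_AbsRing) (coproj M S a)) = Qn z).
    { assert (E : coproj M S (minus a (scal (Cinv c : C_AbsRing) (Qn a)))
                  = coproj M S (opp (scal (Cinv c : C_AbsRing) (Qn z)))) by now rewrite Ha.
      rewrite (linear_minus _ _ _ hP), (linear_opp _ _ hP), !(linear_scal _ hP), !HPQ in E.
      transitivity (scal (Copp c : C_AbsRing)
        (minus (coproj M S a) (scal (Cinv c : C_AbsRing) (Qn a))) : V).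
      - vec. now field.
      - rewrite E. vec. now field. }
    assert (E2 : minus (S (M (N b))) (scal (c : C_AbsRing) (S (M b))) = S (M (N z))).
    { rewrite <- Hb.
      rewrite (linear_minus _ _ _ hN), (linear_scal _ hN), (linear_minus _ _ _ hM),
        (linear_scal _ hM), (linear_minus _ _ _ hS), (linear_scal _ hS).
      f_equal. f_equal. symmetry. apply (sq_outer_inverse M S m hO). }
    unfold shift, w. rewrite (linear_plus _ hN), HNE, HNP.
    transitivity (plus (minus (S (M (N b))) (scal (c : C_AbsRing) (S (M b))))
                       (minus (Qn a) (scal (c : C_AbsRing) (coproj M S a))) : V); [vec|].
    rewrite E1, E2, <- HNE, <- HNP, <- (linear_plus _ hN). f_equal. unfold coproj. vec. }
  assert (HpN : forall k y, p y = zero -> p (sq M k y) = zero).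
  { induction k as [|k IHk]; intros y Hy; simpl; auto. }
  assert (Hpw : p w = zero).
  { apply (sq_shift_preimage p M e hM He Hp m c Hc0 Hce). fold N. rewrite Hw. now apply HpN. }
  replace (p (S (M z))) with (opp (p (minus w (S (M z)))) : W)
    by (rewrite (linear_minus _ _ _ hp), Hpw; vec).
  rewrite norm_opp. eapply Rle_trans; [apply Bp|]. rewrite Rmult_assoc.
  apply Rmult_le_compat_l; [lra|].
  replace (minus w (S (M z))) with (plus (S (M (scal (c : C_AbsRing) (Sn b)))) (coproj M S a) : V).
  - eapply Rle_trans; [apply norm_plus_le|].
    assert (T1 := BE (scal (c : C_AbsRing) (Sn b))). assert (T2 := BSn b).
    assert (T3 := BC a). assert (T4 := BQn z).
    pose proof (norm_ge_0 z). pose proof (norm_ge_0 b).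
    assert (norm (scal (c : C_AbsRing) (Sn b)) <= eta0 * (2 * norm z)) by nra.
    assert (norm a <= eta0 * (2 * norm z)) by nra.
    nra.
  - unfold w. rewrite <- Hb.
    rewrite (linear_minus _ _ _ hM), (linear_minus _ _ _ hS). vec.
Qed.

(** The subspace is also invariant under [S]: with [z' = (I - t S)^-1 z] the element
    [(M - t) S z' = S M z] lies in it, hence so does [S z'], which tends to [S z] as
    [t] tends to [0]. *)
Lemma outer_inverse_invariant {V W : NormedModule C_AbsRing} (p : V -> W) (M S : V -> V) (e : R) :
  seq_complete V -> is_linear p -> is_linear M -> commuting_outer_inverse M S ->
  top_nilpotent (defect M S) -> 0 < e ->
  (forall z, p z = zero -> p (M z) = zero) ->
  (forall l : C, l <> RtoC 0 -> Cmod l < e -> forall z, p (shift M l z) = zero -> p z = zero) ->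
  forall z, p z = zero -> p (S z) = zero.
Proof.
  intros hV hp hM hO HQ He HpM Hp z Hz.
  assert (HE := idempotent_invariant p M S e hV hp hM hO HQ He HpM Hp z Hz).
  destruct hO as [hS [Hc Ho]].
  destruct (linear_norm _ hp) as [kp [Hkp Bp]].
  destruct (linear_norm _ hS) as [ks [Hks BS]].
  apply (norm_small_eq_zero _ (kp * (ks * (ks * (2 * norm z))))).
  intros eta Heta.
  set (t := Rmin eta (Rmin (e / 2) (/ (2 * ks)))).
  assert (Hi : 2 * ks * / (2 * ks) = 1) by (apply Rinv_r; lra).
  assert (Hip : 0 < / (2 * ks)) by (apply Rinv_0_lt_compat; lra).
  assert (Ht : 0 < t) by (repeat apply Rmin_glb_lt; lra).
  assert (Ht1 : t <= eta) by apply Rmin_l.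
  assert (Ht2 : t <= e / 2) by (eapply Rle_trans; [apply Rmin_r|apply Rmin_l]).
  assert (Ht3 : t <= / (2 * ks)) by (eapply Rle_trans; [apply Rmin_r|apply Rmin_r]).
  set (i := / (2 * ks)) in *.
  assert (Htm : Cmod (RtoC t) = t) by (rewrite Cmod_R, Rabs_pos_eq; lra).
  assert (HtS : forall x, 2 * norm (scal (RtoC t : C_AbsRing) (S x)) <= norm x).
  { intros x. rewrite norm_scal_C_eq, Htm. specialize (BS x). pose proof (norm_ge_0 x).
    assert (t * norm (S x) <= i * (ks * norm x)) by (apply Rmult_le_compat; auto using norm_ge_0; lra).
    nra. }
  destruct (neumann_onto (fun x => scal (RtoC t : C_AbsRing) (S x)) hV) with (y := z)
    as [y Hy]; [now apply is_linear_scal|exact HtS|].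
  assert (Ny := neumann_bound (fun x => scal (RtoC t : C_AbsRing) (S x)) HtS y).
  cbv beta in Ny. rewrite Hy in Ny.
  assert (Hpy : p (S y) = zero).
  { apply (Hp (RtoC t)).
    - intros E. apply RtoC_inj in E. lra.
    - lra.
    - replace (shift M (RtoC t) (S y)) with (S (M z)); [exact HE|].
      rewrite <- Hy, (linear_minus _ _ _ hM), (linear_scal _ hM), (linear_minus _ _ _ hS),
        (linear_scal _ hS), Ho. unfold shift. now rewrite Hc. }
  replace (p (S z)) with (opp (p (S (scal (RtoC t : C_AbsRing) (S y)))) : W).
  - rewrite norm_opp. eapply Rle_trans; [apply Bp|]. rewrite Rmult_assoc.
    apply Rmult_le_compat_l; [lra|].
    eapply Rle_trans; [apply BS|]. rewrite Rmult_assoc.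
    apply Rmult_le_compat_l; [lra|]. rewrite norm_scal_C_eq, Htm.
    specialize (BS y). pose proof (norm_ge_0 (S y)). pose proof (norm_ge_0 y).
    assert (t * norm (S y) <= eta * (ks * (2 * norm z))).
    { apply Rmult_le_compat; nra. }
    lra.
  - rewrite <- Hy, (linear_minus _ _ _ hS), (linear_minus _ _ _ hp), Hpy. vec.
Qed.

(** * Upper triangular operators *)

Lemma norm_pair_le {X Y : NormedModule C_AbsRing} (x : X) (y : Y) :
  norm (x, y) <= 2 * (norm x + norm y).
Proof.
  destruct (norm_prod x y) as [_ H]. eapply Rle_trans; [exact H|].
  assert (Hs := sqrt_sqrt 2 ltac:(lra)). pose proof (sqrt_pos 2).
  assert (sqrt 2 <= 2) by nra.
  pose proof (norm_ge_0 x). pose proof (norm_ge_0 y).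
  assert (Rmax (norm x) (norm y) <= norm x + norm y) by (apply Rmax_lub; lra).
  pose proof (Rmax_l (norm x) (norm y)). nra.
Qed.

Lemma seq_complete_prod (X Y : NormedModule C_AbsRing) :
  seq_complete X -> seq_complete Y -> seq_complete (prod_NormedModule C_AbsRing X Y).
Proof.
  intros hX hY u Hu.
  destruct (hX (fun n => fst (u n))) as [x Hx].
  { intros eps He. destruct (Hu eps He) as [N HN]. exists N. intros n m Hn Hm.
    eapply Rle_lt_trans; [|apply (HN n m Hn Hm)].
    exact (norm_le_prod_norm_1 (minus (u n) (u m))). }
  destruct (hY (fun n => snd (u n))) as [y Hy].
  { intros eps He. destruct (Hu eps He) as [N HN]. exists N. intros n m Hn Hm.
    eapply Rle_lt_trans; [|apply (HN n m Hn Hm)].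
    exact (norm_le_prod_norm_2 (minus (u n) (u m))). }
  exists (x, y). intros eps He.
  destruct (Hx (eps / 4)) as [N1 HN1]; [lra|]. destruct (Hy (eps / 4)) as [N2 HN2]; [lra|].
  exists (Nat.max N1 N2). intros n Hn.
  specialize (HN1 n ltac:(lia)). specialize (HN2 n ltac:(lia)).
  eapply Rle_lt_trans; [exact (norm_pair_le (minus (fst (u n)) x) (minus (snd (u n)) y))|].
  lra.
Qed.

Lemma inl_linear {X Y : NormedModule C_AbsRing} :
  is_linear (fun x : X => (x, zero) : prod_NormedModule C_AbsRing X Y).
Proof. apply is_linear_prod; [apply is_linear_id|apply is_linear_zero]. Qed.

Lemma inr_linear {X Y : NormedModule C_AbsRing} :
  is_linear (fun y : Y => (zero, y) : prod_NormedModule C_AbsRing X Y).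
Proof. apply is_linear_prod; [apply is_linear_zero|apply is_linear_id]. Qed.

Lemma upper_triangular_linear {X Y : NormedModule C_AbsRing}
    (A : X -> X) (B : Y -> Y) (C0 : Y -> X) :
  is_linear A -> is_linear B -> is_linear C0 ->
  is_linear (V := prod_NormedModule C_AbsRing X Y) (upper_triangular A B C0).
Proof.
  intros hA hB hC. apply is_linear_prod.
  - apply is_linear_add.
    + exact (is_linear_comp _ A is_linear_fst hA).
    + exact (is_linear_comp _ C0 is_linear_snd hC).
  - exact (is_linear_comp _ B is_linear_snd hB).
Qed.

(** Applied below to restrictions and quotients. *)
Lemma top_nilpotent_of_sq_bound {V W : NormedModule C_AbsRing}
    (T : V -> V) (U : W -> W) (j : W -> V) :
  is_linear j -> (forall m w, norm (sq U m w) <= norm (sq T m (j w))) ->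
  top_nilpotent T -> top_nilpotent U.
Proof.
  intros hj HU HT r eps Hr He. destruct (linear_norm _ hj) as [k [Hk Hj]].
  destruct (HT r (eps / k) Hr) as [m0 Hm0]; [now apply Rdiv_lt_0_compat|].
  exists m0. intros m Hm w.
  apply Rle_trans with (r ^ (2 ^ m) * norm (sq T m (j w))).
  - apply Rmult_le_compat_l; [now apply pow_le|apply HU].
  - eapply Rle_trans; [apply (Hm0 m Hm)|].
    apply Rle_trans with (eps / k * (k * norm w)).
    + apply Rmult_le_compat_l; [apply Rlt_le; now apply Rdiv_lt_0_compat|apply Hj].
    + right. field. lra.
Qed.

(** Either spectral hypothesis implies that, for all small [l <> 0], an element which
    [M - l] maps into the first summand lies itself in the first summand.  If [B - l] is
    injective this is read off the second component.  If [A - l] has dense range then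
    every element of the first summand is a limit of images of elements of that summand,
    and [M - l] is bounded below. *)
Lemma upper_triangular_preimage {X Y : NormedModule C_AbsRing}
    (A : X -> X) (B : Y -> Y) (C0 : Y -> X)
    (S : prod_NormedModule C_AbsRing X Y -> prod_NormedModule C_AbsRing X Y) :
  is_linear A -> is_linear B -> is_linear C0 ->
  commuting_outer_inverse (upper_triangular A B C0) S ->
  quasinilpotent (defect (upper_triangular A B C0) S) ->
  (~ acc (sigma_d A) (RtoC 0) \/ ~ acc (sigma_p B) (RtoC 0)) ->
  exists e, 0 < e /\ forall l : C, l <> RtoC 0 -> Cmod l < e ->
    forall z : prod_NormedModule C_AbsRing X Y,
      snd (shift (upper_triangular A B C0 : prod_NormedModule C_AbsRing X Y -> _) l z) = zero ->
      snd z = zero.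
Proof.
  intros hA hB hC hO hQ hAB.
  assert (hM := upper_triangular_linear A B C0 hA hB hC).
  assert (Hacc : forall K : C -> Prop, ~ acc K (RtoC 0) ->
     exists e, 0 < e /\ forall l, l <> RtoC 0 -> Cmod l < e -> ~ K l).
  { intros K H. apply not_all_ex_not in H. destruct H as [e H].
    apply imply_to_and in H. destruct H as [He H]. exists e. split; [exact He|].
    intros l Hl Hle HK. apply H. exists l. split; [exact HK|]. split; [exact Hl|].
    replace (Cminus l (RtoC 0)) with l by ring. exact Hle. }
  destruct hAB as [hAB|hAB]; destruct (Hacc _ hAB) as [e [He HK]].
  - destruct (shift_bounded_below _ S hM hO hQ) as [t [Ht Hbb]].
    exists (Rmin e t). split; [now apply Rmin_glb_lt|].
    intros l Hl Hlt z Hz.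
    assert (Hle : Cmod l < e) by (eapply Rlt_le_trans; [exact Hlt|apply Rmin_l]).
    assert (Hlt' : Cmod l < t) by (eapply Rlt_le_trans; [exact Hlt|apply Rmin_r]).
    destruct (Hbb l Hl Hlt') as [k [Hk Hb]].
    assert (Hd := NNPP _ (HK l Hl Hle)).
    apply (norm_small_eq_zero _ (k * 2)). intros eps Heps.
    set (w := shift (upper_triangular A B C0 : prod_NormedModule C_AbsRing X Y -> _) l z) in *.
    destruct (Hd (fst w) eps Heps) as [v [[u Hu] Hv]]. subst v.
    set (z' := minus z ((u, zero) : prod_NormedModule C_AbsRing X Y)).
    assert (Hs : snd z' = snd z).
    { change (minus (snd z) zero = snd z). vec. }
    assert (E : shift (upper_triangular A B C0 : prod_NormedModule C_AbsRing X Y -> _) l z'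
                = (minus (fst w) (shift A l u), zero)).
    { unfold z'. rewrite (linear_minus _ _ _ (shift_linear _ l hM)). fold w.
      rewrite (surjective_pairing w) at 1. rewrite Hz.
      apply injective_projections.
      - change (minus (fst w) (minus (plus (A u) (C0 zero)) (scal (l : C_AbsRing) u))
                = minus (fst w) (shift A l u)).
        rewrite (linear_zero _ hC). unfold shift. vec.
      - change (minus zero (minus (B zero) (scal (l : C_AbsRing) zero)) = (zero : Y)).
        rewrite (linear_zero _ hB). vec. }
    rewrite <- Hs. eapply Rle_trans; [exact (norm_le_prod_norm_2 z')|].
    eapply Rle_trans; [apply Hb|]. rewrite E, Rmult_assoc.
    apply Rmult_le_compat_l; [lra|].
    eapply Rle_trans; [apply norm_pair_le|].
    rewrite norm_zero, norm_minus_sym. lra.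
  - exists e. split; [exact He|]. intros l Hl Hle z Hz.
    assert (Hi := NNPP _ (HK l Hl Hle)). apply Hi.
    transitivity (zero : Y); [exact Hz|].
    symmetry. now apply linear_zero, shift_linear.
Qed.

(** A commuting outer inverse of [M], with topologically nilpotent defect, is itself
    upper triangular. *)
Lemma outer_inverse_upper_triangular {X Y : NormedModule C_AbsRing}
    (A : X -> X) (B : Y -> Y) (C0 : Y -> X)
    (S : prod_NormedModule C_AbsRing X Y -> prod_NormedModule C_AbsRing X Y) :
  seq_complete X -> seq_complete Y -> is_linear A -> is_linear B -> is_linear C0 ->
  (~ acc (sigma_d A) (RtoC 0) \/ ~ acc (sigma_p B) (RtoC 0)) ->
  commuting_outer_inverse (upper_triangular A B C0) S ->
  top_nilpotent (defect (upper_triangular A B C0) S) ->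
  forall x : X, snd (S (x, zero)) = zero.
Proof.
  intros hX hY hA hB hC hAB hO hN x.
  assert (hM := upper_triangular_linear A B C0 hA hB hC).
  assert (hV : seq_complete (prod_NormedModule C_AbsRing X Y)).
  { now apply seq_complete_prod. }
  assert (hQ : quasinilpotent (defect (upper_triangular A B C0) S)).
  { apply top_nilpotent_quasinilpotent; [exact hV| |exact hN].
    apply defect_linear; [exact hM|apply hO]. }
  destruct (upper_triangular_preimage A B C0 S hA hB hC hO hQ hAB) as [e [He Hp]].
  apply (outer_inverse_invariant (fun z : prod_NormedModule C_AbsRing X Y => snd z)
           _ S e hV is_linear_snd hM hO hN He); [|exact Hp|reflexivity].
  intros z Hz. change (B (snd z) = zero). rewrite Hz. now apply linear_zero.
Qed.

(** The diagonal entries of [S]. *)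
Definition entry11 {X Y : NormedModule C_AbsRing}
    (S : prod_NormedModule C_AbsRing X Y -> prod_NormedModule C_AbsRing X Y) : X -> X :=
  fun x => fst (S (x, zero)).

Definition entry22 {X Y : NormedModule C_AbsRing}
    (S : prod_NormedModule C_AbsRing X Y -> prod_NormedModule C_AbsRing X Y) : Y -> Y :=
  fun y => snd (S (zero, y)).

Lemma entry11_linear {X Y : NormedModule C_AbsRing}
    (S : prod_NormedModule C_AbsRing X Y -> prod_NormedModule C_AbsRing X Y) :
  is_linear S -> is_linear (entry11 S).
Proof.
  intros hS. unfold entry11.
  exact (is_linear_comp _ _ (is_linear_comp _ S inl_linear hS) is_linear_fst).
Qed.

Lemma entry22_linear {X Y : NormedModule C_AbsRing}
    (S : prod_NormedModule C_AbsRing X Y -> prod_NormedModule C_AbsRing X Y) :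
  is_linear S -> is_linear (entry22 S).
Proof.
  intros hS. unfold entry22.
  exact (is_linear_comp _ _ (is_linear_comp _ S inr_linear hS) is_linear_snd).
Qed.

Lemma outer_inverse_inl {X Y : NormedModule C_AbsRing}
    (S : prod_NormedModule C_AbsRing X Y -> prod_NormedModule C_AbsRing X Y) :
  (forall x : X, snd (S (x, zero)) = zero) ->
  forall x : X, S (x, zero) = (entry11 S x, zero).
Proof. intros H x. rewrite (surjective_pairing (S (x, zero))). now rewrite H. Qed.

Lemma outer_inverse_snd {X Y : NormedModule C_AbsRing}
    (S : prod_NormedModule C_AbsRing X Y -> prod_NormedModule C_AbsRing X Y) :
  is_linear S -> (forall x : X, snd (S (x, zero)) = zero) ->
  forall z, snd (S z) = entry22 S (snd z).
Proof.
  intros hS H z.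
  assert (E : z = plus ((fst z, zero) : prod_NormedModule C_AbsRing X Y) (zero, snd z)).
  { apply injective_projections.
    - change (fst z = plus (fst z) zero). vec.
    - change (snd z = plus zero (snd z)). vec. }
  rewrite E at 1. rewrite (linear_plus _ hS).
  change (plus (snd (S (fst z, zero))) (entry22 S (snd z)) = entry22 S (snd z)).
  rewrite H. vec.
Qed.

Lemma upper_triangular_inl {X Y : NormedModule C_AbsRing}
    (A : X -> X) (B : Y -> Y) (C0 : Y -> X) :
  is_linear B -> is_linear C0 ->
  forall x : X, upper_triangular A B C0 (x, zero) = (A x, zero).
Proof.
  intros hB hC x. unfold upper_triangular. simpl.
  rewrite (linear_zero _ hB), (linear_zero _ hC). f_equal. vec.
Qed.

Lemma iter_intertwine {V W : Type} (T : V -> V) (U : W -> W) (f : V -> W) :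
  (forall x, f (T x) = U (f x)) -> forall k x, f (Nat.iter k T x) = Nat.iter k U (f x).
Proof. intros H k x. induction k as [|k IH]; simpl; [reflexivity|]. now rewrite H, IH. Qed.

(** The theorem for spaces in which norm-Cauchy sequences converge.  The embedding of
    [X] intertwines [A] with [M] and [entry11 S] with [S], the projection onto [Y]
    intertwines [M] with [B] and [S] with [entry22 S]; every relation between [M] and [S] is
    transported along these maps. *)
Lemma diagonal_invertibility
  (X Y : NormedModule C_AbsRing) (HX : seq_complete X) (HY : seq_complete Y)
  (A : X -> X) (B : Y -> Y)
  (hA : is_linear A) (hB : is_linear B)
  (hAB : ~ acc (sigma_d A) (RtoC 0) \/ ~ acc (sigma_p B) (RtoC 0)) :
  ((exists C : Y -> X,
      is_linear C /\ generalized_drazin_invertible (upper_triangular A B C)) ->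
    generalized_drazin_invertible A /\ generalized_drazin_invertible B) /\
  ((exists C : Y -> X,
      is_linear C /\ drazin_invertible (upper_triangular A B C)) ->
    drazin_invertible A /\ drazin_invertible B) /\
  ((exists C : Y -> X,
      is_linear C /\ invertible (upper_triangular A B C)) ->
    invertible A /\ invertible B).
Proof.
  pose (V := prod_NormedModule C_AbsRing X Y).
  (* intertwining relations satisfied by the diagonal entries of [S] *)
  assert (Hmain : forall (C0 : Y -> X) (S : V -> V),
    is_linear C0 -> commuting_outer_inverse (upper_triangular A B C0) S ->
    top_nilpotent (defect (upper_triangular A B C0) S) ->
    (forall x : X, ((A x, zero) : V) = upper_triangular A B C0 (x, zero)) /\
    (forall x : X, ((entry11 S x, zero) : V) = S (x, zero)) /\
    (forall z : V, snd (upper_triangular A B C0 z) = B (snd z)) /\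
    (forall z : V, snd (S z) = entry22 S (snd z))).
  { intros C0 S hC hO hN.
    assert (H := outer_inverse_upper_triangular A B C0 S HX HY hA hB hC hAB hO hN).
    repeat split.
    - intros x. symmetry. now apply upper_triangular_inl.
    - intros x. symmetry. now apply outer_inverse_inl.
    - apply outer_inverse_snd; [apply hO|exact H]. }
  assert (Hinl : forall x x' : X, ((x, zero) : V) = (x', zero) -> x = x')
    by (intros x x' E; now injection E).
  assert (Hsnd : forall y : Y, snd ((zero, y) : V) = y) by reflexivity.
  split; [|split].
  - intros [C0 [hC [S [hS [Hc [Ho Hq]]]]]].
    assert (hM := upper_triangular_linear A B C0 hA hB hC).
    assert (hO : commuting_outer_inverse (upper_triangular A B C0) S) by now split.
    assert (hD := defect_linear _ S hM hS).
    assert (hN := quasinilpotent_top_nilpotent _ hD Hq).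
    destruct (Hmain C0 S hC hO hN) as [EA [E1 [EB E2]]].
    assert (h1 := entry11_linear S hS). assert (h2 := entry22_linear S hS).
    split.
    + exists (entry11 S). split; [exact h1|]. split; [|split].
      * intros x. apply Hinl. now rewrite EA, !E1, EA, Hc.
      * intros x. apply Hinl. now rewrite E1, EA, E1, Ho.
      * apply top_nilpotent_quasinilpotent; [exact HX|now apply (defect_linear A)|].
        apply (top_nilpotent_of_sq_bound _ _ (fun x : X => (x, zero) : V) inl_linear
                 ) with (2 := hN).
        intros m x.
        rewrite <- (sq_intertwine (defect A (entry11 S)) _ (fun x : X => (x, zero) : V)).
        -- exact (norm_le_prod_norm_1 (sq (defect A (entry11 S)) m x, zero)).
        -- intros y. unfold defect.
           rewrite (linear_minus (fun x : X => (x, zero) : V) _ _ inl_linear).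
           now rewrite !EA, E1, EA.
    + exists (entry22 S). split; [exact h2|]. split; [|split].
      * intros y. rewrite <- (Hsnd y). now rewrite <- E2, <- !EB, <- E2, Hc.
      * intros y. rewrite <- (Hsnd y). now rewrite <- E2, <- EB, <- E2, Ho.
      * apply top_nilpotent_quasinilpotent; [exact HY|now apply (defect_linear B)|].
        apply (top_nilpotent_of_sq_bound _ _ (fun y : Y => (zero, y) : V) inr_linear
                 ) with (2 := hN).
        intros m y. rewrite <- (Hsnd y) at 1.
        rewrite <- (sq_intertwine (defect (upper_triangular A B C0) S) _ (fun z : V => snd z)).
        -- exact (norm_le_prod_norm_2 (sq (defect (upper_triangular A B C0) S) m (zero, y))).
        -- intros z. unfold defect.
           rewrite <- EB, <- E2, <- EB. reflexivity.
  - intros [C0 [hC [S [k [hS [Hc [Ho Hk]]]]]]].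
    assert (hM := upper_triangular_linear A B C0 hA hB hC).
    assert (hO : commuting_outer_inverse (upper_triangular A B C0) S) by now split.
    assert (hN := drazin_defect_top_nilpotent _ S k hM hO Hk).
    destruct (Hmain C0 S hC hO hN) as [EA [E1 [EB E2]]].
    split.
    + exists (entry11 S), k. split; [now apply entry11_linear|]. split; [|split].
      * intros x. apply Hinl. now rewrite EA, !E1, EA, Hc.
      * intros x. apply Hinl. now rewrite E1, EA, E1, Ho.
      * intros x. apply Hinl.
        rewrite !(iter_intertwine A (upper_triangular A B C0) (fun x : X => (x, zero) : V) EA).
        now rewrite E1, EA.
    + exists (entry22 S), k. split; [now apply entry22_linear|]. split; [|split].
      * intros y. rewrite <- (Hsnd y). now rewrite <- E2, <- !EB, <- E2, Hc.
      * intros y. rewrite <- (Hsnd y). now rewrite <- E2, <- EB, <- E2, Ho.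
      * intros y. rewrite <- (Hsnd y). rewrite <- EB, <- E2.
        rewrite <- !(iter_intertwine (upper_triangular A B C0) B (fun z : V => snd z) EB).
        now rewrite Hk.
  - intros [C0 [hC [S [hS [HSM HMS]]]]].
    assert (hM := upper_triangular_linear A B C0 hA hB hC).
    assert (hO : commuting_outer_inverse (upper_triangular A B C0) S).
    { split; [exact hS|]. split; intros z; now rewrite ?HMS, ?HSM. }
    assert (hN : top_nilpotent (defect (upper_triangular A B C0) S)).
    { apply (drazin_defect_top_nilpotent _ S 0 hM hO). exact HSM. }
    destruct (Hmain C0 S hC hO hN) as [EA [E1 [EB E2]]].
    split.
    + exists (entry11 S). split; [now apply entry11_linear|]. split; intros x; apply Hinl.
      * now rewrite E1, EA, HSM.
      * now rewrite EA, E1, HMS.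
    + exists (entry22 S). split; [now apply entry22_linear|].
      split; intros y; rewrite <- (Hsnd y).
      * now rewrite <- EB, <- E2, HSM.
      * now rewrite <- E2, <- EB, HMS.
Qed.

Theorem theorem2p8
  (X Y : CompleteNormedModule C_AbsRing)
  (A : X -> X) (B : Y -> Y)
  (hA : is_linear A) (hB : is_linear B)
  (hAB : ~ acc (sigma_d A) (RtoC 0) \/ ~ acc (sigma_p B) (RtoC 0)) :
  ((exists C : Y -> X,
      is_linear C /\ generalized_drazin_invertible (upper_triangular A B C)) ->
    generalized_drazin_invertible A /\ generalized_drazin_invertible B) /\
  ((exists C : Y -> X,
      is_linear C /\ drazin_invertible (upper_triangular A B C)) ->
    drazin_invertible A /\ drazin_invertible B) /\
  ((exists C : Y -> X,
      is_linear C /\ invertible (upper_triangular A B C)) ->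
    invertible A /\ invertible B).
Proof.
  apply (diagonal_invertibility X Y); auto using seq_complete_CompleteNormedModule.
Qed.
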